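(* Assume that $a_t(y,t)\le0$ for any $t,y>0$ and that $g\equiv 0$. Let $u$ be a bounded and stable solution of the boundary reaction-diffusion problem $(P)$ described in the context, such that $$a(y,|\nabla u|)\, |\nabla u|^2 \in L^1(\mathcal{C}),$$ $$\lim_{R\to+\infty}\frac{1}{R^2} \int_{\Omega\times(R,2R)} a(y,|\nabla u|) =0,$$ $$a(y,|\nabla u|)\, \partial_y u \in C(\overline\Omega \times [0,+\infty)).$$ If either $f$ is strictly convex, or $f$ is strictly concave, then $u$ is constant in $\mathcal{C}$.
   Context: Let $n\ge 1$ and let $\Omega\subset\mathbb{R}^n$ be a bounded domain of class $C^{4,\alpha}$, for some $\alpha\in(0,1)$. Put $\mathcal{C}:=\Omega\times(0,+\infty)$, $\partial_L\mathcal{C}:=\partial\Omega\times(0,+\infty)$, $\partial_B\mathcal{C}:=\Omega\times\{0\}$; points of $\mathcal{C}$ are written $X=(x,y)$ with $x\in\Omega$, $y>0$. $\nabla$ is the full gradient in $\mathbb{R}^{n+1}$; $\nabla_x$, $D^2_x$, $D^3_x$ denote derivatives in the $x$ variables only; $\nu=(\tilde\nu,0)\in\mathbb{R}^n\times\mathbb{R}$, with $\tilde\nu$ the outer unit normal to $\partial\Omega$. Data. $f\in C^{2,\alpha}(\mathbb{R})$; $g=g(y,u)$ is continuous in the first variable and locally Lipschitz in the second. The function $a=a(y,t)$ belongs to $C((0,+\infty)\times[0,+\infty))\cap C^1((0,+\infty)\times(0,+\infty))$; $a_t$ is its derivative in the second variable. It is assumed that for all $y>0$, $t\ge0$: $a(y,t)>0$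 and $a(y,t)+t\,a_t(y,t)>0$; that there is $C>0$ with $t\,|a_t(y,t)|\le C\,a(y,t)$ for all $y>0$, $t\ge0$; and that $\lim_{t\to0}t\,a_t(y,t)=0$ for all $y>0$ (at $t=0$ the product $t\,a_t$ is read as $0$). Problem $(P)$: $\mathrm{div}(a(y,|\nabla u|)\nabla u)=g(y,u)$ in $\mathcal{C}$, $\partial_\nu u=0$ on $\partial_L\mathcal{C}$, $-a(y,|\nabla u|)\,\partial_y u=f(u)$ on $\partial_B\mathcal{C}$. Solution. A solution of $(P)$ is a function $u\in C(\overline{\mathcal{C}})\cap C^2(\overline\Omega\times(0,+\infty))$ such that: $\nabla_x u, D^2_xu\in L^2(\Omega\times\{0\})$ (i.e. they have $L^2$ traces on $\Omega\times\{0\}$); $\partial_\nu u(x,y)=0$ for all $(x,y)\in\partial\Omega\times[0,+\infty)$; for all $R>0$, $a(y,|\nabla u|)\big(|\nabla u|^2+|D^2_xu|^2+|\nabla_xu_y|^2+|D^3_xu|^2+|D^2_xu_y|^2\big)\in L^1(\Omega\times(0,R))$; and $$\int_{\mathcal{C}}a(y,|\nabla u|)\nabla u\cdot\nabla\varphi+\int_{\mathcal{C}}g(y,u)\varphi=\int_{\partial_B\mathcal{C}}f(u)\varphi\quad\text{for all }\varphi\in\mathcal{A},$$ where $\mathcal{A}$ is the set of $\varphi\in W^{1,1}_{\rm loc}(\mathcal{C})$ having bounded support in $y$, with $a(y,|\nabla u|)|\nabla\varphi|^2\in L^1(\mathcal{C})$ and $\varphi|_{\Omega\times\{0\}}\in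 L^2(\Omega)$. Matrix $\mathcal{B}$. $\mathcal{B}(y,\eta)_{ij}:=a(y,|\eta|)\delta_{ij}+\frac{a_t(y,|\eta|)}{|\eta|}\eta_i\eta_j$ for $i,j=1,\dots,n+1$, $\eta\in\mathbb{R}^{n+1}$, where the last term is meant to be zero if $\eta=0$. Stability. A solution $u$ is stable if $$I(\varphi):=\int_{\mathcal{C}}\langle\mathcal{B}(y,\nabla u)\nabla\varphi,\nabla\varphi\rangle+\int_{\mathcal{C}}g_u(y,u)\varphi^2-\int_{\partial_B\mathcal{C}}f'(u)\varphi^2\ge0\quad\text{for all }\varphi\in\mathcal{A}.$$ *)

(* Defs.v *)
From HB Require Import structures.
From mathcomp Require Import all_boot all_order all_algebra.
From mathcomp Require Import all_classical all_reals all_analysis.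

Set Implicit Arguments.
Unset Strict Implicit.
Unset Printing Implicit Defensive.

Import Order.TTheory GRing.Theory Num.Theory.
Import numFieldNormedType.Exports.

Local Open Scope classical_set_scope.
Local Open Scope ring_scope.

Definition rV_display : measure_display -> measure_display.
Proof. exact. Qed.

Section rV_measurable.
Context {R : realType}.

Section sigma_algebra.
Variable n : nat.

(* The product sigma-algebra, which is the Borel one. *)
Definition rV_coord (i : 'I_n) (x : 'rV[R]_n) : R := x ord0 i.

Let rV_set0 : g_sigma_preimage rV_coord set0.
Proof. exact: sigma_algebra0. Qed.

Let rV_setC A : g_sigma_preimage rV_coord A -> g_sigma_preimage rV_coord (~` A).
Proof. exact: sigma_algebraC. Qed.

Let rV_bigcup (F : (set 'rV[R]_n)^nat) :
  (forall i, g_sigma_preimage rV_coord (F i)) ->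
  g_sigma_preimage rV_coord (\bigcup_i (F i)).
Proof. exact: sigma_algebra_bigcup. Qed.

HB.instance Definition _ := @isMeasurable.Build
  (rV_display default_measure_display) 'rV[R]_n (g_sigma_preimage rV_coord)
  rV_set0 rV_setC rV_bigcup.

End sigma_algebra.

Lemma measurable_rV_coord n (i : 'I_n) :
  measurable_fun [set: 'rV[R]_n] (@rV_coord n i).
Proof.
move=> _ Y mY; rewrite setTI; apply: sub_sigma_algebra => /=.
rewrite -bigcup_seq/=; exists i => /=; first by rewrite mem_index_enum.
by exists Y => //; rewrite setTI.
Qed.

Lemma measurable_fun_rVP d (T : measurableType d) n (f : T -> 'rV[R]_n) :
  (forall i, measurable_fun [set: T] (fun t => f t ord0 i)) ->
  measurable_fun [set: T] f.
Proof.
move=> mf _ A; rewrite setTI => mA.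
have : g_sigma_preimage (fun i => @rV_coord n i \o f) (f @^-1` A).
  by rewrite g_sigma_preimage_comp; exists A => //; rewrite setTI.
apply: smallest_sub; first exact: sigma_algebra_measurable.
elim/big_ind : _ => //= [B C sB sC|i _].
  by rewrite subUset.
by move=> _ [B mB <-]; exact: mf.
Qed.

Definition rV_cons n (p : measurableTypeR R * 'rV[R]_n) : 'rV[R]_n.+1 :=
  row_mx (const_mx p.1 : 'rV_1) p.2.

Definition rV_uncons n (x : 'rV[R]_n.+1) : measurableTypeR R * 'rV[R]_n :=
  (x ord0 ord0, rsubmx (x : 'rV_(1 + n))).

Lemma rV_consK n : cancel (@rV_cons n) (@rV_uncons n).
Proof.
move=> [t x]; rewrite /rV_cons /rV_uncons row_mxKr; congr pair => /=.
by rewrite mxE; case: splitP => [j _|j //]; rewrite mxE.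
Qed.

Lemma measurable_rV_cons n : measurable_fun setT (@rV_cons n).
Proof.
apply: measurable_fun_rVP => i; rewrite /rV_cons.
case: (splitP (i : 'I_(1 + n))) => j ij.
- rewrite [X in measurable_fun _ X](_ : _ = fst); first exact: measurable_fst.
  apply/funext => -[t x]; rewrite [i](_ : _ = lshift n j); last exact/val_inj.
  exact: etrans (row_mxEl _ _ _ _) (mxE _ _ _ _).
- rewrite [X in measurable_fun _ X](_ : _ = @rV_coord n j \o snd).
    by apply: measurableT_comp; [exact: measurable_rV_coord|exact: measurable_snd].
  apply/funext => -[t x]; rewrite [i](_ : _ = rshift 1 j); last exact/val_inj.
  exact: row_mxEr.
Qed.

Lemma measurable_rV_uncons n : measurable_fun setT (@rV_uncons n).
Proof.
apply: measurable_fun_pair => /=; first exact: (measurable_rV_coord ord0).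
apply: measurable_fun_rVP => i.
rewrite [X in measurable_fun _ X](_ : _ = @rV_coord n.+1 (rshift 1 i)).
  exact: measurable_rV_coord.
by apply/funext => x; rewrite mxE.
Qed.

Section step.
Local Open Scope ereal_scope.
Variables (n : nat) (mu : {sigma_finite_measure set 'rV[R]_n -> \bar R}).

Definition leb_step : set 'rV[R]_n.+1 -> \bar R :=
  pushforward (@lebesgue_measure R \x mu) (@rV_cons n).

Let mpre A : measurable A -> measurable (@rV_cons n @^-1` A).
Proof. by move=> mA; rewrite -[X in measurable X]setTI; exact: measurable_rV_cons. Qed.

Let leb_step0 : leb_step set0 = 0.
Proof. by rewrite /leb_step /pushforward preimage_set0 measure0. Qed.

Let leb_step_ge0 A : 0 <= leb_step A.
Proof. exact: (measure_ge0 (@lebesgue_measure R \x mu)). Qed.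

Let leb_step_sigma_additive : semi_sigma_additive leb_step.
Proof.
move=> F mF tF mUF; rewrite /leb_step /pushforward preimage_bigcup.
apply: measure_semi_sigma_additive.
- by move=> k; exact: mpre.
- apply/trivIsetP => /= i j _ _ ij; rewrite -preimage_setI.
  by move/trivIsetP : tF => /(_ _ _ _ _ ij) ->//; rewrite preimage_set0.
- by rewrite -preimage_bigcup; exact: mpre.
Qed.

HB.instance Definition _ := isMeasure.Build _ _ _ leb_step
  leb_step0 leb_step_ge0 leb_step_sigma_additive.

Let leb_step_sigma_finite : sigma_finite setT leb_step.
Proof.
have /sigma_finiteP[F [TF ndF Foo]] := sigma_finiteT (@lebesgue_measure R).
have /sigma_finiteP[G [TG ndG Goo]] := sigma_finiteT mu.
exists (fun k => @rV_uncons n @^-1` (F k `*` G k)).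
  rewrite -preimage_bigcup (_ : \bigcup_k _ = setT) ?preimage_setT//.
  rewrite -subTset => -[t x] _.
  have [k _ Fkt] : (\bigcup_i F i) t by rewrite -TF.
  have [l _ Glx] : (\bigcup_i G i) x by rewrite -TG.
  exists (maxn k l) => //; split => /=.
  - by move: t Fkt; exact/subsetPset/ndF/leq_maxl.
  - by move: x Glx; exact/subsetPset/ndG/leq_maxr.
move=> k; have [mFk Fkoo] := Foo k; have [mGk Gkoo] := Goo k; split.
  rewrite -[X in measurable X]setTI; apply: measurable_rV_uncons => //.
  exact: measurableX.
rewrite /leb_step /pushforward -comp_preimage.
rewrite (_ : _ \o _ = id) ?preimage_id; last first.
  by apply/funext => p; exact: rV_consK.
by rewrite product_measure1E// lte_mul_pinfty// ge0_fin_numE.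
Qed.

HB.instance Definition _ := Measure_isSigmaFinite.Build _ _ _ leb_step
  leb_step_sigma_finite.

End step.

Fixpoint lebesgue_rV n : {sigma_finite_measure set 'rV[R]_n -> \bar R} :=
  match n with
  | 0 => dirac (0 : 'rV[R]_0)
  | m.+1 => leb_step (lebesgue_rV m)
  end.

End rV_measurable.
Arguments lebesgue_rV : clear implicits.

(* Points of R^{n+1} are pairs (x, y). *)
Definition lebesgue_xy (R : realType) (n : nat) :
    set ('rV[R]_n * measurableTypeR R) -> \bar R :=
  (lebesgue_rV R n \x @lebesgue_measure R)%E.
HB.instance Definition _ R n := Measure.on (@lebesgue_xy R n).
Arguments lebesgue_xy : clear implicits.

Section calculus.
Context {R : realType}.

(* The norm carried by ['rV[R]_m] in the library is the sup norm. *)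
Definition dotp m (u v : 'rV[R]_m) : R := \sum_i u ord0 i * v ord0 i.
Definition enorm m (u : 'rV[R]_m) : R := Num.sqrt (dotp u u).

Section smoothness.
Context {V W : normedModType R}.

Definition iterD (vs : seq V) (f : V -> W) : V -> W :=
  foldr (fun v g => fun x => 'D_v g x) f vs.

Definition Ck (U : set V) (k : nat) (f : V -> W) :=
  forall vs : seq V, (size vs <= k)%N ->
    (forall x, U x -> {for x, continuous (iterD vs f)}) /\
    ((size vs < k)%N -> forall x v, U x -> derivable (iterD vs f) x v).

Definition locally_holder (U : set V) (alpha : R) (f : V -> W) :=
  forall x, U x -> exists r M : R, 0 < r /\
    forall y z, U y -> U z -> ball x r y -> ball x r z ->
      `|f y - f z| <= M * `|y - z| `^ alpha.

(* On an open set U, C^{k,alpha}(U) is meant locally in U. *)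
Definition Cka (U : set V) (k : nat) (alpha : R) (f : V -> W) :=
  Ck U k f /\
  forall vs : seq V, size vs = k -> locally_holder U alpha (iterD vs f).

Definition extends_continuously (U E : set V) (f : V -> W) :=
  exists h : V -> W, {within E, continuous h} /\ forall x, U x -> h x = f x.

End smoothness.

Definition strictly_convex (f : R -> R) :=
  forall s t l : R, s != t -> 0 < l < 1 ->
    f (l * s + (1 - l) * t) < l * f s + (1 - l) * f t.

Definition strictly_concave (f : R -> R) := strictly_convex (fun s => - f s).

End calculus.

Section domains.
Context {R : realType} {n : nat}.
Implicit Types Om : set 'rV[R]_n.

Definition boundary Om := closure Om `\` interior Om.

Definition bounded_domain Om :=
  [/\ open Om, connected Om, Om !=set0 & bounded_set Om].

(* Local flattening of the boundary by C^{k,alpha} diffeomorphisms, as in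
   Gilbarg-Trudinger, Section 6.2. *)
Definition of_class Om (k : nat) (alpha : R) :=
  forall x0, boundary Om x0 ->
  exists (r : R) (psi phi : 'rV[R]_n -> 'rV[R]_n) (i : 'I_n),
    let B := ball x0 r in
    [/\ 0 < r,
        open (psi @` B) /\ (forall x, B x -> phi (psi x) = x),
        forall x, B x -> Om x -> 0 < psi x ord0 i,
        forall x, B x -> boundary Om x -> psi x ord0 i = 0 &
        Cka B k alpha psi /\ Cka (psi @` B) k alpha phi].

(* v is the outer unit normal at the boundary point x: it is orthogonal to the
   limits of secant directions of the boundary and points out of Om. *)
Definition outer_normal Om (x v : 'rV[R]_n) :=
  [/\ enorm v = 1,
      dotp (z - x) v / enorm (z - x) @[z --> within (boundary Om) (x^')] --> 0 &
      \forall h \near 0^'+, Om (x - h *: v) /\ ~ closure Om (x + h *: v)].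

End domains.

Section cylinder.
Context {R : realType} {n : nat}.
Local Notation point := ('rV[R]_n * R)%type.
Local Notation mu := (lebesgue_xy R n).
Local Notation mux := (lebesgue_rV R n).
Implicit Types (Om : set 'rV[R]_n) (D : set point) (u phi : point -> R).

Definition slab Om (r s : R) : set point := [set X | Om X.1 /\ r < X.2 < s].
Definition cyl Om : set point := [set X | Om X.1 /\ 0 < X.2].
Definition cyl_halfopen Om : set point := [set X | closure Om X.1 /\ 0 < X.2].
Definition cyl_closed Om : set point := [set X | closure Om X.1 /\ 0 <= X.2].

Definition axis_x (i : 'I_n) : point := (delta_mx ord0 i, 0).
Definition axis_y : point := (0, 1).
Definition axis (k : 'I_(n + 1)) : point :=
  match fintype.split k with inl i => axis_x i | inr _ => axis_y end.

Definition grad u (X : point) : 'rV[R]_(n + 1) := \row_k 'D_(axis k) u X.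

Definition loc_integrable D phi :=
  measurable_fun (D : set ('rV[R]_n * measurableTypeR R)) phi /\
  forall K : set point, compact K -> K `<=` D ->
    (\int[mu]_(X in K) `|phi X|%:E < +oo)%E.

Definition test_function D (psi : point -> R^o) :=
  (forall k, Ck setT k psi) /\
  exists K : set point,
    [/\ compact K, K `<=` D & forall X, ~ K X -> psi X = 0].

Definition weak_derivative D (v : point) phi (psi : point -> R) :=
  [/\ loc_integrable D phi, loc_integrable D psi &
      forall eta, test_function D eta ->
        (\int[mu]_(X in D) (phi X * 'D_v eta X)%:E =
         - \int[mu]_(X in D) (psi X * eta X)%:E)%E].

(* phi belongs to W^{1,1}_loc(D), with weak gradient G. *)
Definition W11_loc D phi (G : point -> 'rV[R]_(n + 1)) :=
  forall k, weak_derivative D (axis k) phi (fun X => G X ord0 k).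

Definition L2 Om (T : 'rV[R]_n -> R) :=
  measurable_fun Om T /\ mux.-integrable Om (fun x => (T x ^+ 2)%:E).

(* T is the trace of phi on Om x {0}: the averages of |phi(x,y) - T(x)| over
   0 < y < r tend to 0 in L^1_loc(Om). This is insensitive to null sets. *)
Definition has_trace Om phi (T : 'rV[R]_n -> R) :=
  forall K : set 'rV[R]_n, compact K -> K `<=` Om ->
    ((r^-1)%:E * \int[mu]_(X in slab K 0 r) `|phi X - T X.1|%:E)%E
      @[r --> 0^'+] --> 0%E.

Definition has_L2_trace Om phi := exists T, has_trace Om phi T /\ L2 Om T.

Definition diffusion_coefficient (a : R -> R -> R) :=
  let a_t y := derive1 (a y : R -> R^o) in
  [/\ {within [set p : R^o * R^o | 0 < p.1 /\ 0 <= p.2],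
         continuous (fun p => a p.1 p.2 : R^o)},
      Ck [set p : R^o * R^o | 0 < p.1 /\ 0 < p.2] 1
         (fun p => a p.1 p.2 : R^o),
      (* At t = 0 the product [t * a_t y t] is 0, as intended. *)
      forall y t, 0 < y -> 0 <= t -> 0 < a y t /\ 0 < a y t + t * a_t y t,
      exists2 C : R, 0 < C &
        forall y t, 0 < y -> 0 <= t -> t * `|a_t y t| <= C * a y t &
      forall y, 0 < y -> t * a_t y t @[t --> 0^'+] --> 0].

Definition reaction (g : R -> R -> R) :=
  (forall s, {within [set y : R | 0 < y], continuous (fun y => g y s)}) /\
  (forall y s, 0 < y -> exists r L : R, 0 < r /\
    forall s1 s2, ball s r s1 -> ball s r s2 ->
      `|g y s1 - g y s2| <= L * `|s1 - s2|).

Section problem.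
Variables (Om : set 'rV[R]_n) (a g : R -> R -> R) (f : R -> R).

Definition weight u (X : point) : R := a X.2 (enorm (grad u X)).

(* phi, with weak gradient G and trace T, belongs to the class A of test
   functions. *)
Definition admissible u phi (G : point -> 'rV[R]_(n + 1)) T :=
  [/\ W11_loc (cyl Om) phi G,
      exists M : R, forall X, cyl Om X -> M <= X.2 -> phi X = 0,
      mu.-integrable (cyl Om) (fun X => (weight u X * enorm (G X) ^+ 2)%:E) &
      has_trace Om phi T /\ L2 Om T].

(* One-sided, since u is only defined on the closure of the cylinder. *)
Definition normal_derivative_is u (x v : 'rV[R]_n) (y l : R) :=
  (- h)^-1 * (u (x - h *: v, y) - u (x, y)) @[h --> 0^'+] --> l.

(* In the energy, the third order derivatives are weak ones: D3 i j k stands for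
   u_{x_i x_j x_k} and D2y i j for u_{x_i x_j y}. *)
Definition finite_energy u :=
  exists (D3 : 'I_n -> 'I_n -> 'I_n -> point -> R)
         (D2y : 'I_n -> 'I_n -> point -> R),
  [/\ forall i j k, weak_derivative (cyl Om) (axis_x k)
        (iterD [:: axis_x i; axis_x j] (u : point -> R^o)) (D3 i j k),
      forall i j, weak_derivative (cyl Om) (axis_x i)
        (iterD [:: axis_x j; axis_y] (u : point -> R^o)) (D2y i j) &
      forall r : R, 0 < r -> mu.-integrable (slab Om 0 r) (fun X =>
        (weight u X *
          (enorm (grad u X) ^+ 2
           + \sum_i \sum_j iterD [:: axis_x i; axis_x j] (u : point -> R^o) X ^+ 2
           + \sum_i iterD [:: axis_x i; axis_y] (u : point -> R^o) X ^+ 2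
           + \sum_i \sum_j \sum_k D3 i j k X ^+ 2
           + \sum_i \sum_j D2y i j X ^+ 2))%:E)].

(* The integrals are extended-real valued, so that no junk value arises when g phi
   fails to be integrable: the other two terms are always finite, since
   a |grad u|^2 is integrable on bounded slabs and u is bounded on Om x {0}. *)
Definition weak_equation u :=
  forall phi G T, admissible u phi G T ->
    (\int[mu]_(X in cyl Om) (weight u X * dotp (grad u X) (G X))%:E
     + \int[mu]_(X in cyl Om) (g X.2 (u X) * phi X)%:E
     = \int[mux]_(x in Om) (f (u (x, 0%R)) * T x)%:E)%E.

Record solution u : Prop := Solution {
  sol_continuous : {within cyl_closed Om, continuous u} ;
  sol_C2 : Ck (cyl Om) 2 (u : point -> R^o) ;
  sol_C2_closure : forall vs : seq point, (size vs <= 2)%N ->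
    extends_continuously (cyl Om) (cyl_halfopen Om)
      (iterD vs (u : point -> R^o)) ;
  sol_trace1 : forall i, has_L2_trace Om (iterD [:: axis_x i] (u : point -> R^o)) ;
  sol_trace2 : forall i j,
    has_L2_trace Om (iterD [:: axis_x i; axis_x j] (u : point -> R^o)) ;
  sol_neumann : forall x v y, boundary Om x -> outer_normal Om x v -> 0 <= y ->
    normal_derivative_is u x v y 0 ;
  sol_energy : finite_energy u ;
  sol_weak : weak_equation u
}.

(* For eta = 0 the second summand vanishes, as intended, since 0^-1 = 0. *)
Definition Bmat (y : R) (eta : 'rV[R]_(n + 1)) : 'M[R]_(n + 1) :=
  \matrix_(i, j) (a y (enorm eta) * (i == j)%:R
    + derive1 (a y : R -> R^o) (enorm eta) / enorm eta * eta ord0 i * eta ord0 j).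

Definition stable u :=
  forall phi G T, admissible u phi G T ->
    (0 <= \int[mu]_(X in cyl Om)
            (dotp (G X *m (Bmat X.2 (grad u X))^T) (G X))%:E
          + \int[mu]_(X in cyl Om) (derive1 (g X.2 : R -> R^o) (u X) * phi X ^+ 2)%:E
          - \int[mux]_(x in Om) (derive1 (f : R -> R^o) (u (x, 0%R)) * T x ^+ 2)%:E)%E.

End problem.
End cylinder.

(* Main.v *)
Require Import Defs.
From HB Require Import structures.
From mathcomp Require Import all_boot all_order all_algebra.
From mathcomp Require Import all_classical all_reals all_analysis.
From mathcomp Require Import measurable_realfun ring lra.

Set Implicit Arguments.
Unset Strict Implicit.
Unset Printing Implicit Defensive.

Import Order.TTheory GRing.Theory Num.Theory.
Import numFieldNormedType.Exports.

Local Open Scope classical_set_scope.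
Local Open Scope ring_scope.

(** Put w = a(y, |grad u|) and U(x) = u(x, 0). The solution is tested only against
    functions h(u) sigma(y), with h of class C^1 on the line and sigma a cutoff in
    the vertical variable. Let tau be a cutoff that equals 1 for y <= r and 0 for
    y >= 2r, with |tau'| <= 4/r. By the growth hypothesis the integral of w tau'^2 is
    as small as desired for suitable r (growth_cutoff); as the integral of w |grad u|^2
    is finite, every term that contains tau' is then negligible. This gives

    - from the weak equation with h(u) tau^2 (weak_estimate),
      int f(U) h(U) = int w h'(u) tau^2 |grad u|^2 + o(1);
    - from stability with h(u) tau (stability_estimate),
      int f'(U) h(U)^2 <= int w h'(u)^2 tau^2 |grad u|^2 + o(1),
      because a_t <= 0 makes the stability matrix at most w times the identity.

    For h = 1 the first relation says that f(U) has zero mean. If 0 <= h' <= 1, then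
    h'^2 <= h' and subtracting the two relations yields (stability_profile)
    int h(U) (f(U) - f'(U) h(U)) >= 0.

    Let f be strictly convex. The tangent inequality reads
    f(s) - f'(s) h(s) < f(s - h(s)) whenever h(s) <> 0. If f(U) were negative at some
    point x, one could choose h >= 0 zero up to a level c slightly below U(x) and such
    that s - h(s) stays in a small interval on which f < 0; the integrand above would
    be nonpositive, and negative near x, which is impossible. Hence f(U) >= 0, and so
    f(U) = 0 by the zero mean (convex_reaction_eq0). The concave case follows by
    passing to -u and to the reaction s |-> - f(-s).

    Once f(U) = 0, the first relation with h = id shows that w |grad u|^2 integrates
    to zero (grad_eq0), and u is constant because Om is connected
    (constant_of_grad_eq0).

    Most of the work is to show that h(u) sigma(y) is an admissible test function
    (test_admissible). Its weak gradient is the classical one, which rests on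
    integration by parts against compactly supported functions; that formula comes
    from the translation invariance of Lebesgue measure and dominated convergence
    (integral_derive_compact_support). *)

(** * Borel sets and continuous functions *)

Lemma measurable_countable_union d (T : measurableType d) (I : countType)
    (B : I -> set T) (A : set T) :
    (forall i, measurable (B i)) ->
    (forall x, A x -> exists2 i, B i x & B i `<=` A) ->
  measurable A.
Proof.
move=> mB AB.
pose F k : set T := if @unpickle I k is Some i then
  (if `[<B i `<=` A>] then B i else set0) else set0.
have -> : A = \bigcup_k F k.
  apply/seteqP; split => [x /AB[i Bix BiA]|x [k _]].
    by exists (pickle i) => //; rewrite /F pickleK asboolT.
  rewrite /F; case: unpickle => [i|//].
  by case: asboolP => [BA|_ //]; exact: BA.
apply: bigcupT_measurable => k; rewrite /F; case: unpickle => [i|//].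
by case: asboolP.
Qed.

Section borel.
Context {R : realType}.

Lemma rat_near (x r : R) : 0 < r -> exists q : rat, ball x r (ratr q).
Proof.
move=> r0; have /rat_in_itvoo[q /itvP qre] : x - r < x + r by lra.
by exists q; rewrite ball_itv/= in_itv/= !qre.
Qed.

Lemma rV_ball_bigcap n (x : 'rV[R]_n) r : 0 < r ->
  ball x r = \bigcap_(i in [set: 'I_n]) (rV_coord i @^-1` ball (x ord0 i) r).
Proof.
move=> r0; apply/seteqP; split => y /=.
  by case=> _ xy i _; exact: xy.
by move=> xy; split => // i j; rewrite [i]ord1; exact: xy.
Qed.

Lemma measurable_rV_ball n (x : 'rV[R]_n) r : measurable (ball x r).
Proof.
have [r0|r0] := leP r 0; last first.
  rewrite rV_ball_bigcap//; apply: fin_bigcap_measurable => // i _.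
  rewrite -[X in measurable X]setTI; apply: measurable_rV_coord => //.
  by rewrite ball_itv; exact: measurable_itv.
rewrite (_ : ball x r = set0)//; apply/seteqP; split => // y [].
by rewrite ltNge r0.
Qed.

Lemma rV_rat_near n (x : 'rV[R]_n) (r : R) : 0 < r ->
  exists q : 'rV[rat]_n, ball x r (map_mx ratr q).
Proof.
move=> r0; have /choice[q qP] (i : 'I_n) := rat_near (x ord0 i) r0.
by exists (\row_i q i); split => // i j; rewrite !mxE [i]ord1; exact: qP.
Qed.

(** The norm is the sup norm, so its balls are boxes, which belong to the product
    sigma-algebra; an open set is the union of the countably many balls with
    rational centre and radius that it contains. *)
Lemma open_measurable_rV n (A : set 'rV[R]_n) : open A -> measurable A.
Proof.
move=> oA; pose B (p : 'rV[rat]_n * rat) : set 'rV[R]_n :=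
  ball (map_mx ratr p.1 : 'rV[R]_n) (ratr p.2).
apply: (@measurable_countable_union _ _ _ B).
  by move=> p; exact: measurable_rV_ball.
move=> x Ax; have /nbhs_ballP[e /= e0 xeA] := open_nbhs_nbhs (conj oA Ax).
have /rat_in_itvoo[r /itvP rP] : 0 < e / 2 by rewrite divr_gt0.
have r0 : 0 < (ratr r : R) by rewrite rP.
have [q qP] := rV_rat_near x r0.
exists (q, r) => [|z qz]; rewrite /B /=; first exact: ball_sym.
apply: xeA; apply: (@le_ball _ _ _ (ratr r + ratr r)).
  have : ratr r < e / 2 :> R by rewrite rP.
  lra.
exact: ball_triangle qP qz.
Qed.

Local Notation mpoint n := ('rV[R]_n * measurableTypeR R)%type.

Lemma open_measurable_xy n (A : set ('rV[R]_n * R)) :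
  open A -> measurable (A : set (mpoint n)).
Proof.
move=> oA; pose B (p : 'rV[rat]_n * rat * rat) : set (mpoint n) :=
  ball (map_mx ratr p.1.1 : 'rV[R]_n) (ratr p.2) `*` ball (ratr p.1.2 : R) (ratr p.2).
apply: (@measurable_countable_union _ _ _ B).
  move=> p; apply: measurableX; first exact: measurable_rV_ball.
  by rewrite ball_itv; exact: measurable_itv.
move=> [x y] Ax; have /nbhs_ballP[e /= e0 xeA] := open_nbhs_nbhs (conj oA Ax).
have /rat_in_itvoo[r /itvP rP] : 0 < e / 2 by rewrite divr_gt0.
have r0 : 0 < (ratr r : R) by rewrite rP.
have [q qP] := rV_rat_near x r0.
have [s sP] := rat_near y r0.
exists (q, s, r) => [|z [qz sz]]; rewrite /B /=.
  by split; exact: ball_sym.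
apply: xeA; apply: (@le_ball _ _ _ (ratr r + ratr r)).
  have : ratr r < e / 2 :> R by rewrite rP.
  lra.
by split; [exact: ball_triangle qP qz|exact: ball_triangle sP sz].
Qed.

(** The map phi passes from the measurable structure to the topological one when these
    are carried by two presentations of the same set. *)
Lemma continuous_open_measurable d (T : measurableType d) (V : topologicalType)
    (phi : T -> V) (D : set V) (f : V -> R) :
    (forall A, open A -> measurable (phi @^-1` A)) ->
    open D -> (forall x, D x -> {for x, continuous f}) ->
  measurable_fun (phi @^-1` D) (f \o phi).
Proof.
move=> om oD cf mD; apply: (measurability _ (RGenOpens.measurableE R)) => //.
move=> _ [_ [a [b ->] <-]].
rewrite [X in measurable X](_ : _ = phi @^-1` (D `&` f @^-1` `]a, b[))//.
apply: om.
rewrite openE => x [Dx fx]; apply: filterI; first exact: open_nbhs_nbhs.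
by apply: (cf _ Dx); apply: open_nbhs_nbhs; split => //; exact: interval_open.
Qed.

Lemma continuous_measurable_rV n (D : set 'rV[R]_n) (f : 'rV[R]_n -> R) :
  open D -> (forall x, D x -> {for x, continuous f}) -> measurable_fun D f.
Proof.
move=> oD cf.
exact: (@continuous_open_measurable _ 'rV[R]_n _ id D f (@open_measurable_rV n)).
Qed.

Lemma continuous_measurable_xy n (D : set ('rV[R]_n * R)) (f : 'rV[R]_n * R -> R) :
  open D -> (forall x, D x -> {for x, continuous f}) ->
  measurable_fun (D : set (mpoint n)) f.
Proof.
move=> oD cf.
exact: (@continuous_open_measurable _ (mpoint n) ('rV[R]_n * R)%type id D f
  (@open_measurable_xy n)).
Qed.

Lemma compact_measurable_xy n (K : set ('rV[R]_n * R)) :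
  compact K -> measurable (K : set (mpoint n)).
Proof.
move=> /compact_closed cK; rewrite -[K]setCK; apply: measurableC.
by apply: open_measurable_xy; apply: closed_openC; apply: cK; exact: norm_hausdorff.
Qed.

Lemma compact_measurable_rV n (K : set 'rV[R]_n) : compact K -> measurable K.
Proof.
move=> /compact_closed cK; rewrite -[K]setCK; apply: measurableC.
by apply: open_measurable_rV; apply: closed_openC; apply: cK; exact: norm_hausdorff.
Qed.

End borel.

(** * Translation invariance and the measure of balls *)

Lemma product_measure_invariant d1 d2 (T1 : measurableType d1)
    (T2 : measurableType d2) (R : realType)
    (m1 : {sigma_finite_measure set T1 -> \bar R})
    (m2 : {sigma_finite_measure set T2 -> \bar R})
    (p1 : T1 -> T1) (p2 : T2 -> T2) :
    measurable_fun setT p1 -> measurable_fun setT p2 ->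
    (forall A, measurable A -> m1 (p1 @^-1` A) = m1 A) ->
    (forall A, measurable A -> m2 (p2 @^-1` A) = m2 A) ->
  forall A, measurable A ->
    (m1 \x m2)%E ((fun x => (p1 x.1, p2 x.2)) @^-1` A) = (m1 \x m2)%E A.
Proof.
move=> mp1 mp2 inv1 inv2 A mA.
pose p (x : T1 * T2) := (p1 x.1, p2 x.2).
have mp : measurable_fun setT p.
  by apply: measurable_fun_pair => /=; exact: measurableT_comp.
pose mp_mixin := isMeasurableFun.Build _ _ _ _ _ mp.
pose mp_pack : {mfun _ >-> _} := HB.pack p mp_mixin.
apply/esym; rewrite [LHS](@product_measure_unique _ _ _ _ _ m1 m2
  (pushforward (m1 \x m2)%E mp_pack))// => B C mB mC.
transitivity ((m1 \x m2)%E ((p1 @^-1` B) `*` (p2 @^-1` C))); first by [].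
have mpB : measurable (p1 @^-1` B).
  by rewrite -[X in measurable X]setTI; exact: mp1.
have mpC : measurable (p2 @^-1` C).
  by rewrite -[X in measurable X]setTI; exact: mp2.
rewrite [LHS]product_measure1E//; congr (_ * _)%E; [exact: inv1|exact: inv2].
Qed.

Section measures.
Context {R : realType}.
Local Notation mpoint n := ('rV[R]_n * measurableTypeR R)%type.

Lemma measurable_translation_R (t : R) :
  measurable_fun setT (fun x : measurableTypeR R => x + t : measurableTypeR R).
Proof. by apply: measurable_funD => //; exact: measurable_id. Qed.

Lemma lebesgue_measure_translation (t : R) (A : set (measurableTypeR R)) :
  measurable A ->
  lebesgue_measure ((fun x => x + t) @^-1` A) = lebesgue_measure A.
Proof.
move=> mA; apply/esym.
pose mp_mixin := isMeasurableFun.Build _ _ _ _ _ (measurable_translation_R t).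
pose mp_pack : {mfun (measurableTypeR R) >-> (measurableTypeR R)} := HB.pack
  (fun x : measurableTypeR R => x + t : measurableTypeR R) mp_mixin.
rewrite (@lebesgue_measure_unique _ (pushforward lebesgue_measure mp_pack))//.
move=> _ [[a b] _ <-]; transitivity (lebesgue_measure (`]a - t, b - t]%classic : set R)); last first.
  congr (lebesgue_measure _); apply/seteqP.
  split => x; rewrite /preimage/= !in_itv/= => /andP[? ?]; apply/andP; lra.
by rewrite !lebesgue_measure_itv/= !lte_fin ltrD2r -!EFinB opprB addrA subrK.
Qed.

Lemma rV_cons_preimage_ball n (x : 'rV[R]_n.+1) r :
  @rV_cons R n @^-1` ball x r = ball (rV_uncons x).1 r `*` ball (rV_uncons x).2 r.
Proof.
apply/seteqP; split => [[t y]|[t y]] /=.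
- case=> r0 xy; split => /=.
    have := xy ord0 ord0; rewrite /rV_cons /= [X in ball _ _ X]mxE.
    by case: splitP => // j _; rewrite mxE.
  split => // i j; rewrite mxE; have := xy i (rshift 1 j).
  by rewrite [X in ball _ _ X]row_mxEr.
- case=> /= xt [r0 xy]; split => // i j; rewrite [i]ord1 /rV_cons /=.
  rewrite [X in ball _ _ X]mxE; case: splitP => k jk; rewrite /= .
    by rewrite mxE (_ : j = ord0)//; apply/val_inj/(etrans jk); rewrite [k]ord1.
  have := xy ord0 k; rewrite mxE (_ : rshift 1 k = j)//.
  exact/val_inj/esym.
Qed.

Lemma lebesgue_rV_ball n (x : 'rV[R]_n) r : 0 < r ->
  lebesgue_rV R n (ball x r) = ((r *+ 2) ^+ n)%:E.
Proof.
move=> r0; elim: n x => [|n IH] x /=.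
  rewrite expr0 diracE mem_set//; split => // i j.
  by case: j.
rewrite /leb_step /pushforward rV_cons_preimage_ball.
rewrite product_measure1E//; first last.
- exact: measurable_rV_ball.
- by rewrite ball_itv; exact: measurable_itv.
rewrite exprS EFinM; congr (_ * _)%E; last exact: IH.
exact: (lebesgue_measure_ball _ (ltW r0)).
Qed.

Lemma measurable_translation_rV n (v : 'rV[R]_n) :
  measurable_fun setT (fun x : 'rV[R]_n => x + v).
Proof.
apply: measurable_fun_rVP => i.
rewrite (_ : (fun t => _) = (fun t => rV_coord i t + v ord0 i)); last first.
  by apply/funext => t; rewrite mxE.
apply: (@measurable_funD _ _ _ _ (@rV_coord R n i)) => //.
exact: measurable_rV_coord.
Qed.

(** By induction on the dimension, peeling off one coordinate at a time: invariance
    of the two factors passes to a product measure by uniqueness of the latter. *)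
Lemma lebesgue_rV_translation n (v : 'rV[R]_n) A : measurable A ->
  lebesgue_rV R n ((fun x => x + v) @^-1` A) = lebesgue_rV R n A.
Proof.
elim: n v A => [|n IH] v A mA /=.
  rewrite (_ : _ @^-1` A = A)//; apply/seteqP.
  by split => x /=; rewrite [x + v]thinmx0 [x]thinmx0.
rewrite /leb_step /pushforward.
have mA' : measurable (@rV_cons R n @^-1` A).
  by rewrite -[X in measurable X]setTI; exact: measurable_rV_cons.
rewrite -(product_measure_invariant
  (measurable_translation_R (rV_uncons v).1)
  (measurable_translation_rV (rV_uncons v).2)
  (@lebesgue_measure_translation (rV_uncons v).1) (IH (rV_uncons v).2) mA').
congr (_ _); apply/seteqP; rewrite /preimage/=.
suff E p : rV_cons p + v = rV_cons (p.1 + v ord0 ord0, p.2 + rsubmx (v : 'rV_(1+n))).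
  by split => p /=; rewrite E.
apply/rowP => j; rewrite !mxE; case: splitP => k jk; rewrite !mxE /=.
  by rewrite (_ : j = ord0)//; apply/val_inj/(etrans jk); rewrite [k]ord1.
by rewrite (_ : rshift 1 k = j)//; exact/val_inj/esym.
Qed.

Lemma measurable_translation_xy n (V : 'rV[R]_n * R) :
  measurable_fun setT (fun X : mpoint n => (X + V : 'rV[R]_n * R) : mpoint n).
Proof.
apply: measurable_fun_pair => /=.
  by apply: measurableT_comp (measurable_translation_rV _) _; exact: measurable_fst.
by apply: measurableT_comp (measurable_translation_R _) _; exact: measurable_snd.
Qed.

Lemma lebesgue_xy_translation n (V : 'rV[R]_n * R) (A : set (mpoint n)) :
  measurable A ->
  lebesgue_xy R n ((fun X : 'rV[R]_n * R => X + V) @^-1` A) = lebesgue_xy R n A.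
Proof.
move=> mA; exact: (product_measure_invariant
  (measurable_translation_rV V.1) (measurable_translation_R V.2)
  (@lebesgue_rV_translation n V.1) (@lebesgue_measure_translation V.2) mA).
Qed.

Lemma lebesgue_xyX n (A : set 'rV[R]_n) (B : set (measurableTypeR R)) :
  measurable A -> measurable B ->
  lebesgue_xy R n (A `*` B) = (lebesgue_rV R n A * lebesgue_measure B)%E.
Proof. exact: product_measure1E. Qed.

Lemma lebesgue_xy_ball n (X : 'rV[R]_n * R) r : 0 < r ->
  lebesgue_xy R n (ball X r) = ((r *+ 2) ^+ n.+1)%:E.
Proof.
move=> r0; rewrite [LHS](@lebesgue_xyX _ (ball X.1 r) (ball X.2 r)).
- rewrite exprSr EFinM; congr (_ * _)%E; first exact: lebesgue_rV_ball.
  exact: (lebesgue_measure_ball _ (ltW r0)).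
- exact: measurable_rV_ball.
- by rewrite ball_itv; exact: measurable_itv.
Qed.

Lemma lebesgue_rV_bounded n (A : set 'rV[R]_n) :
  measurable A -> bounded_set A -> (lebesgue_rV R n A < +oo)%E.
Proof.
move=> mA [M [Mr MA]].
have r0 : 0 < `|M| + 2 by rewrite ltr_wpDl.
apply: (@le_lt_trans _ _ (lebesgue_rV R n (ball 0 (`|M| + 2)))); last first.
  by rewrite lebesgue_rV_ball// ltry.
apply: le_measure; rewrite ?inE//; first exact: measurable_rV_ball.
move=> x Ax; rewrite -ball_normE /ball_/= sub0r normrN.
have M1 : M < `|M| + 1 by rewrite (le_lt_trans (ler_norm _))// ltrDl.
by apply: (le_lt_trans (MA _ M1 x Ax)); rewrite ltrD2l ltr1n.
Qed.

Lemma lebesgue_xy_bounded n (A : set ('rV[R]_n * R)) :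
  measurable (A : set (mpoint n)) -> bounded_set A -> (lebesgue_xy R n A < +oo)%E.
Proof.
move=> mA [M [Mr MA]].
have r0 : 0 < `|M| + 2 by rewrite ltr_wpDl.
apply: (@le_lt_trans _ _ (lebesgue_xy R n (ball (0 : 'rV[R]_n * R) (`|M| + 2)))); last first.
  by rewrite lebesgue_xy_ball// ltry.
apply: le_measure; rewrite ?inE//.
  by apply: open_measurable_xy; exact: ball_open.
move=> x Ax; rewrite -ball_normE /ball_/= sub0r normrN.
have M1 : M < `|M| + 1 by rewrite (le_lt_trans (ler_norm _))// ltrDl.
by apply: (le_lt_trans (MA _ M1 x Ax)); rewrite ltrD2l ltr1n.
Qed.

End measures.

(** * Integral inequalities *)

Section integrability.
Context d (T : measurableType d) (R : realType) (mu : {measure set T -> \bar R}).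

Lemma integrable_bounded_support (D B : set T) (M : R) (W : T -> R) :
    measurable D -> measurable B -> (mu B < +oo)%E -> measurable_fun D W ->
    (forall x, D x -> B x -> `|W x| <= M) ->
    (forall x, D x -> ~ B x -> W x = 0) ->
  mu.-integrable D (fun x => (W x)%:E).
Proof.
move=> mD mB Boo mW WM W0.
have mWE : measurable_fun D (fun x => (W x)%:E) by exact/measurable_EFinP.
have iDB : mu.-integrable (D `&` B) (fun x => (W x)%:E).
  apply: measurable_bounded_integrable; first exact: measurableI.
  - apply: le_lt_trans Boo; apply: le_measure; rewrite ?inE//.
    exact: measurableI.
  - exact: measurable_funS mW.
  - exists M; split => //; first exact: num_real.
    by move=> x Mx y [Dy By]; rewrite /= (le_trans (WM _ Dy By))// ltW.
apply/integrable_mkcond => //.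
have := (integrable_mkcond _ (measurableI _ _ mD mB)).1 iDB.
apply: eq_integrable => [|x _]; first exact: measurableT.
rewrite /patch in_setI.
case: (boolP (x \in D)) => //= /set_mem Dx; case: (boolP (x \in B)) => //.
by rewrite notin_setE => nBx; rewrite W0.
Qed.

Lemma Rintegral_lower_bound (D B : set T) (c m : R) (W : T -> R) :
    measurable D -> measurable B -> B `<=` D -> (m%:E <= mu B)%E -> 0 <= c ->
    mu.-integrable D (EFin \o W) -> (forall x, D x -> 0 <= W x) ->
    (forall x, B x -> c <= W x) ->
  c * m <= \int[mu]_(x in D) W x.
Proof.
move=> mD mB BD mB_ge c0 iW W0 cW.
have mW : measurable_fun D (EFin \o W) by case/integrableP : iW.
rewrite -lee_fin /Rintegral fineK; last exact: integrable_fin_num.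
apply: (@le_trans _ _ (\int[mu]_(x in B) (W x)%:E)%E); last first.
  by apply: ge0_subset_integral => // x Dx; rewrite lee_fin W0.
apply: (@le_trans _ _ (\int[mu]_(x in B) (cst c%:E x))%E).
  by rewrite integral_cst// EFinM lee_wpmul2l.
by apply: ge0_le_integral => //; exact: measurable_funS mW.
Qed.

(** The integral of a nonnegative function is the supremum over the simple functions
    below it, so it is monotone on arbitrary functions. Stability is compared with the
    weighted energy in this way: its quadratic form involves a_t / |grad u|, which
    is singular at the zeros of the gradient. *)
Lemma integral_le_nonmeasurable (D : set T) (F1 F2 : T -> \bar R) :
    (forall x, D x -> 0 <= F2 x)%E -> (forall x, D x -> F1 x <= F2 x)%E ->
  (\int[mu]_(x in D) F1 x <= \int[mu]_(x in D) F2 x)%E.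
Proof.
move=> F20 F12; rewrite integralE.
apply: (@le_trans _ _ (\int[mu]_(x in D) F1^\+ x)%E).
  by apply: geeDl; rewrite oppe_le0; apply: integral_ge0 => x _; exact: funeneg_ge0.
rewrite !(integral_mkcond D) ge0_integralTE; last first.
  by move=> x; apply: erestrict_ge0 => y _; exact: funepos_ge0.
rewrite ge0_integralTE; last by move=> x; exact: erestrict_ge0.
apply: le_ereal_sup => _ /= [k kF <-]; exists k => // x.
apply: (le_trans (kF x)); rewrite /patch; case: ifPn => // /set_mem Dx.
by rewrite funeposE ge_max F12// F20.
Qed.

End integrability.

(** * Integration by parts *)

Section calculus_on_lines.
Context {R : realType} {V : normedModType R}.
Implicit Types F : V -> R^o.

Lemma is_derive_line F (X v : V) (s : R) : derivable F (s *: v + X) v ->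
  is_derive s (1 : R) (fun s : R => F (s *: v + X) : R^o) ('D_v F (s *: v + X)).
Proof.
set G := fun s : R => _.
have E : (fun h : R => h^-1 *: (G (h *: 1 + s) - G s)) =
    (fun h : R => h^-1 *: (F (h *: v + (s *: v + X)) - F (s *: v + X))).
  by apply/funext => h; rewrite /G [h *: 1]mulr1 scalerDl addrA.
move=> dF; split; first by rewrite /derivable E.
by rewrite /derive E.
Qed.

(** The mean value theorem on the line through X directed by v; it provides the
    domination of difference quotients in the passage to the limit below. *)
Lemma le_increment F (X v : V) (M : R) :
    (forall Y, derivable F Y v) -> (forall Y, `|'D_v F Y| <= M) ->
  forall t, 0 < t -> `|F (t *: v + X) - F X| <= M * t.
Proof.
move=> dF FM t t0; pose G := fun s : R => F (s *: v + X).
have dG s : is_derive s (1 : R) (G : R -> R^o) ('D_v F (s *: v + X)).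
  exact: is_derive_line.
have cG : {within `[0, t], continuous (G : R -> R^o)}.
  apply: derivable_within_continuous => s _; exact: (@ex_derive _ _ _ _ _ _ _ (dG s)).
have [c _] := MVT t0 (fun s _ => dG s) cG.
rewrite /G scale0r add0r subr0 => ->.
by rewrite normrM (gtr0_norm t0) ler_wpM2r// ltW.
Qed.

Lemma derive_eq_near0 F (X v : V) : (\near X, F X = 0) ->
  is_derive X v F 0.
Proof.
move=> F0; have : is_derive X v (cst 0 : V -> R^o) 0 by exact: is_derive_cst.
have [->|v0] := eqVneq v 0; first by move=> _; exact: is_derive0.
apply: near_eq_is_derive => //.
by near=> Y; rewrite /cst; apply/esym; near: Y.
Unshelve. all: by end_near. Qed.

Lemma continuous_eq_near0 F (X : V) : (\near X, F X = 0) -> {for X, continuous F}.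
Proof.
move=> F0; have FX : F X = 0 by exact: nbhs_singleton F0.
rewrite /prop_for /continuous_at FX; apply: (@cvg_trans _ ((cst 0 : V -> R^o) @ X)); last exact: cvg_cst.
by apply: near_eq_cvg; near=> Y; apply/esym; near: Y.
Unshelve. all: by end_near. Qed.

Lemma compact_bound (K : set V) F : compact K ->
  (forall X, K X -> {for X, continuous F}) -> exists M : R, forall X, K X -> `|F X| <= M.
Proof.
move=> cK cF.
have cF' : {within K, continuous F}.
  by apply: continuous_in_subspaceT => X /set_mem; exact: cF.
have /compact_bounded[M [Mr MK]] := continuous_compact cF' cK.
exists (M + 1) => X KX; apply: (MK (M + 1)); first by rewrite ltrDl.
by exists X.
Qed.

End calculus_on_lines.

Section integration_by_parts.
Context {R : realType} {n : nat}.
Local Notation point := ('rV[R]_n * R)%type.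
Local Notation mpoint := ('rV[R]_n * measurableTypeR R)%type.
Local Notation mu := (lebesgue_xy R n).
Implicit Types (D K : set point) (F phi psi : point -> R^o) (v : point).

Lemma compact_lebesgue_xy_fin K : compact K -> (mu K < +oo)%E.
Proof.
by move=> cK; apply: lebesgue_xy_bounded;
  [exact: compact_measurable_xy|exact: compact_bounded].
Qed.

Lemma integrable_compact_support D K (W : point -> R^o) : open D -> compact K ->
    K `<=` D -> (forall X, D X -> {for X, continuous W}) ->
    (forall X, D X -> ~ K X -> W X = 0) ->
  mu.-integrable D (fun X => (W X)%:E).
Proof.
move=> oD cK KD cW W0.
have [M MK] := compact_bound cK (fun X KX => cW X (KD X KX)).
apply: (@integrable_bounded_support _ mpoint _ mu D K M) => //.
- exact: open_measurable_xy.
- exact: compact_measurable_xy.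
- exact: compact_lebesgue_xy_fin.
- exact: continuous_measurable_xy.
- by move=> X _; exact: MK.
Qed.

Lemma integral_translation F v : mu.-integrable setT (fun X => (F X)%:E) ->
    (forall X, {for X, continuous F}) ->
  (mu.-integrable setT (fun X => (F (X + v))%:E) /\
  (\int[mu]_X (F (X + v))%:E = \int[mu]_X (F X)%:E))%E.
Proof.
move=> iF cF; have mF : measurable_fun [set: mpoint] F.
  by apply: continuous_measurable_xy => //; exact: openT.
pose tr := fun X : mpoint => ((X : point) + v : point) : mpoint.
have mtr : measurable_fun setT tr := measurable_translation_xy v.
pose mtr_mixin := isMeasurableFun.Build _ _ _ _ _ mtr.
pose mtr_pack : {mfun mpoint >-> mpoint} := HB.pack tr mtr_mixin.
have mFE : measurable_fun [set: mpoint] (fun X => (F X)%:E) by exact/measurable_EFinP.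
have mFtr : measurable_fun [set: mpoint] (fun X => (F (tr X))%:E).
  exact: (measurableT_comp mFE mtr).
have E (H : mpoint -> \bar R) :
    (\int[pushforward mu mtr_pack]_X H X = \int[mu]_X H X)%E.
  apply: eq_measure_integral => A mA _; exact: lebesgue_xy_translation.
have iFtr : mu.-integrable setT (fun X => (F (tr X))%:E).
  apply/integrableP; split => //.
  have /integrableP[_] := iF; apply: le_lt_trans.
  rewrite -[leRHS]E [leRHS](@ge0_integral_pushforward _ _ mpoint mpoint R tr mtr mu)//.
  exact: measurableT_comp.
split => //.
rewrite -[RHS]E; apply/esym.
exact: (@integral_pushforward _ _ mpoint mpoint R tr mtr mu setT _ mFE iFtr measurableT).
Qed.

(** The integral of a difference quotient of F in the direction v vanishes by
    translation invariance, and the quotients converge boundedly to the derivative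
    inside a fixed ball. No coordinate is singled out, so horizontal and vertical
    directions are treated alike. *)
Lemma integral_derive_compact_support F K v : compact K ->
    (forall X, {for X, continuous F}) -> (forall X, derivable F X v) ->
    (forall X, {for X, continuous ('D_v F)}) -> (forall X, ~ K X -> F X = 0) ->
  (\int[mu]_X ('D_v F X)%:E = 0)%E.
Proof.
move=> cK cF dF cDF F0.
have oKC : open (~` K).
  by apply: closed_openC; apply: compact_closed => //; exact: norm_hausdorff.
have DF0 X : ~ K X -> 'D_v F X = 0.
  move=> nKX; apply: (@derive_val _ _ _ _ _ _ _ _).
  apply: derive_eq_near0; apply: filterS (open_nbhs_nbhs (conj oKC nKX)).
  by move=> Y; exact: F0.
have [M MK] := compact_bound cK (fun X _ => cDF X).
have M'K X : `|'D_v F X| <= `|M|.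
  have [KX|nKX] := pselect (K X); last by rewrite DF0// normr0.
  by rewrite (le_trans (MK _ KX))// ler_norm.
have [N [Nr NK]] := compact_bounded cK.
have N1 : N < `|N| + 1 by rewrite (le_lt_trans (ler_norm _))// ltrDl.
have KN X : K X -> `|X| <= `|N| + 1 by exact: NK.
pose t k : R := k.+1%:R^-1.
have t0 k : 0 < t k by rewrite invr_gt0.
have t1 k : t k <= 1 by rewrite /t invf_le1 ?ltr0n// ler1n.
pose Fk k (X : mpoint) := ((t k)^-1 * (F (t k *: v + X) - F X))%:E.
(* B contains the support of F and all its translates by - t k *: v. *)
pose B : set point := ball (0 : point) (`|N| + 1 + `|v| + 1).
have r0 : 0 < `|N| + 1 + `|v| + 1 by rewrite ltr_wpDl// addr_ge0// addr_ge0.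
have muB : (mu B < +oo)%E by rewrite /B lebesgue_xy_ball// ltry.
have Fk0 k X : ~ B X -> F (t k *: v + X) - F X = 0.
  rewrite /B -ball_normE /ball_/= sub0r normrN => /negP; rewrite -leNgt => XB.
  have nK : ~ K X by move=> /KN XN; have := normr_ge0 v; lra.
  rewrite F0 ?F0 ?subrr// => /KN; apply/negP; rewrite -ltNge.
  have : `|X| <= `|t k *: v + X| + `|t k *: v|.
    by rewrite -{1}[X](addKr (t k *: v)) addrC; exact: ler_normB.
  have : `|t k *: v| <= `|v|.
    rewrite normrZ; apply: ler_piMl => //.
    by rewrite (ger0_norm (ltW (t0 k))).
  lra.
have mT := @measurableT _ mpoint.
have iF : mu.-integrable setT (fun X => (F X)%:E).
  by apply: (integrable_compact_support openT cK) => // X _; exact: F0.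
have [] := @dominated_convergence _ mpoint R mu setT mT Fk
  (fun X => ('D_v F X)%:E) (fun X => (`|M| * \1_B X)%:E).
- move=> k; apply/measurable_EFinP.
  apply: (continuous_measurable_xy openT) => X _.
  apply: continuousM; first exact: cst_continuous.
  apply: continuousB; last exact: cF.
  apply: (@continuous_comp _ _ _ (fun Y => t k *: v + Y) F); last exact: cF.
  apply: continuousD; [exact: cst_continuous|exact: cvg_id].
- apply/measurable_EFinP; apply: (continuous_measurable_xy openT) => X _.
  exact: cDF.
- apply: aeW => X _; apply: cvg_EFin; first by near=> k.
  have dX : (h^-1 *: (F (h *: v + X) - F X)) @[h --> 0^'] --> 'D_v F X := dF X.
  have /cvg_at_rightP := cvg_dnbhs_at_right dX; apply; split => //.
  exact: cvg_harmonic.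
- have iB : mu.-integrable setT (fun X => (\1_B X)%:E).
    apply: (@integrable_bounded_support _ mpoint _ mu setT B 1) => //.
    - by apply: open_measurable_xy; exact: ball_open.
    - by apply: measurable_indic; apply: open_measurable_xy; exact: ball_open.
    - by move=> X _ BX; rewrite indicE mem_set// normr1.
    - by move=> X _ nBX; rewrite indicE memNset.
  have := integrableZl mT `|M| iB.
  by apply: eq_integrable => // X _; rewrite EFinM.
- apply: aeW => X k _; rewrite /Fk /= lee_fin.
  have [BX|nBX] := pselect (B X); last by rewrite Fk0// mulr0 normr0 mulr_ge0.
  rewrite indicE mem_set// mulr1 normrM gtr0_norm ?invr_gt0// ler_pdivrMl// mulrC.
  exact: le_increment.
move=> _ _ lim.
apply: (@cvg_unique _ _ _ _ _ _ lim) => //.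
rewrite (_ : (fun _ => _) = cst 0%E); first exact: cvg_cst.
apply/funext => k; rewrite /Fk.
have [iFt EFt] := integral_translation (t k *: v) iF cF.
transitivity (((t k)^-1)%:E *
    \int[mu]_X ((F (X + t k *: v))%:E - (F X)%:E))%E.
  rewrite -integralZl//; last exact: integrableB.
  apply: eq_integral => X _; rewrite -EFinB -EFinM; congr ((_ * (F _ - _))%:E).
  exact: addrC.
by rewrite integralB_EFin// EFt subee ?mule0//; exact: integrable_fin_num.
Unshelve. all: by end_near. Qed.

Lemma continuous_loc_integrable D phi : open D ->
    (forall X, D X -> {for X, continuous phi}) -> loc_integrable D phi.
Proof.
move=> oD cphi; have mphi := continuous_measurable_xy oD cphi.
split=> // K cK KD.
have [M MK] := compact_bound cK (fun X KX => cphi X (KD X KX)).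
have mK : measurable (K : set mpoint) by exact: compact_measurable_xy.
have : mu.-integrable K (fun X => (phi X)%:E).
  apply: (@integrable_bounded_support _ mpoint _ mu K K M) => //.
  - exact: compact_lebesgue_xy_fin.
  - by apply: measurable_funS mphi => //; exact: open_measurable_xy.
  - by move=> X _; exact: MK.
by case/integrableP.
Qed.

(** The product of phi with a test function is globally C^1 along v once extended by
    zero, so the previous lemma applies to it and the product rule gives the
    integration by parts formula. *)
Lemma C1_weak_derivative D v phi psi : open D ->
    (forall X, D X -> {for X, continuous phi}) ->
    (forall X, D X -> is_derive X v phi (psi X)) ->
    (forall X, D X -> {for X, continuous psi}) ->
  weak_derivative D v phi psi.
Proof.
move=> oD cphi dphi cpsi.
split; [exact: continuous_loc_integrable|exact: continuous_loc_integrable|].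
move=> eta [Ceta [K [cK KD eta0]]].
have oKC : open (~` K).
  by apply: closed_openC; apply: compact_closed => //; exact: norm_hausdorff.
have nearKC X : ~ K X -> \near X, (~` K) X.
  by move=> nKX; exact: open_nbhs_nbhs.
have ceta X : {for X, continuous eta} by exact: (Ceta 0 [::] isT).1.
have deta X : is_derive X v eta ('D_v eta X).
  by apply: derivableP; exact: (Ceta 1 [::] isT).2.
have cDeta X : {for X, continuous ('D_v eta)} by exact: (Ceta 1 [:: v] isT).1.
have Deta0 X : ~ K X -> 'D_v eta X = 0.
  move=> /nearKC nKX; apply: (@derive_val _ _ _ _ _ _ _ _).
  by apply: derive_eq_near0; apply: filterS nKX => Y; exact: eta0.
pose F : point -> R^o := phi * eta.
pose W X : R^o := phi X * 'D_v eta X + psi X * eta X.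
have F0 X : ~ K X -> F X = 0.
  have -> : F X = phi X * eta X by [].
  by move=> /eta0 ->; rewrite mulr0.
have dF X : is_derive X v F (W X).
  have [KX|nKX] := pselect (K X).
    have dphiX := dphi X (KD _ KX).
    apply: (is_derive_eq (is_deriveM dphiX (deta X))).
    by rewrite /W [psi X * _]mulrC.
  rewrite /W eta0// Deta0// !mulr0 addr0.
  apply: derive_eq_near0; apply: filterS (nearKC _ nKX) => Y; exact: F0.
have DFE X : 'D_v F X = W X by exact: (@derive_val _ _ _ _ _ _ _ (dF X)).
have cF X : {for X, continuous F}.
  have [KX|nKX] := pselect (K X).
    by apply: continuousM; [apply: cphi; exact: KD|exact: ceta].
  by apply: continuous_eq_near0; apply: filterS (nearKC _ nKX) => Y; exact: F0.
pose W1 X : R^o := phi X * 'D_v eta X.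
pose W2 X : R^o := psi X * eta X.
have cW1 X : D X -> {for X, continuous W1}.
  by move=> DX; apply: continuousM; [exact: cphi|exact: cDeta].
have cW2 X : D X -> {for X, continuous W2}.
  by move=> DX; apply: continuousM; [exact: cpsi|exact: ceta].
have W10 X : ~ K X -> W1 X = 0 by move=> nKX; rewrite /W1 Deta0// mulr0.
have W20 X : ~ K X -> W2 X = 0 by move=> nKX; rewrite /W2 eta0// mulr0.
have cDF X : {for X, continuous ('D_v F)}.
  rewrite (_ : 'D_v F = W); last by apply/funext.
  have [KX|nKX] := pselect (K X).
    by apply: continuousD; [apply: cW1; exact: KD|apply: cW2; exact: KD].
  apply: continuous_eq_near0; apply: filterS (nearKC _ nKX) => Y nKY.
  by rewrite [LHS](congr2 +%R (W10 _ nKY) (W20 _ nKY)) addr0.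
have I0 := integral_derive_compact_support cK cF
  (fun X => @ex_derive _ _ _ _ _ _ _ (dF X)) cDF F0.
have i1 : mu.-integrable D (fun X => (W1 X)%:E).
  by apply: (integrable_compact_support oD cK) => // X _; exact: W10.
have i2 : mu.-integrable D (fun X => (W2 X)%:E).
  by apply: (integrable_compact_support oD cK) => // X _; exact: W20.
have mD : measurable (D : set mpoint) by exact: open_measurable_xy.
have : (\int[mu]_(X in D) ((W1 X)%:E + (W2 X)%:E) = 0)%E.
  rewrite -[RHS]I0 [LHS]integral_mkcond; apply: eq_integral => X _.
  rewrite DFE /patch; case: ifPn => [//|]; rewrite notin_setE => nDX.
  have nKX : ~ K X by move=> /KD.
  by rewrite [W X](congr2 +%R (W10 _ nKX) (W20 _ nKX)) addr0.
rewrite integralD//.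
have := integrable_fin_num mD i1; have := integrable_fin_num mD i2.
rewrite -/(W1 _); move=> /fineK <- /fineK <-.
by rewrite -EFinD -EFinN => -[/eqP]; rewrite addr_eq0 => /eqP ->.
Qed.

End integration_by_parts.

(** * Functions of one variable *)

Section one_variable.
Context {R : realType}.

Definition pospart (t : R) : R := Num.max 0 t.

(** The square of the positive part is the building block of all the profiles below:
    it is C^1, and composing or subtracting copies of it replaces gluing. *)
Definition sqpos (t : R) : R := pospart t ^+ 2.

Lemma pospartP t : (t <= 0 /\ pospart t = 0) \/ (0 <= t /\ pospart t = t).
Proof. by rewrite /pospart; case: (leP 0 t) => t0; [right|left; split => //; exact: ltW]. Qed.

Lemma pospart_ge0 t : 0 <= pospart t.
Proof. by rewrite le_max lexx. Qed.

Lemma continuous_pospart : continuous (pospart : R -> R^o).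
Proof. by move=> t; apply: continuous_max; [exact: cst_continuous|exact: cvg_id]. Qed.

(** A remainder bounded by h^2 makes the difference quotient converge; this handles
    the kink of the positive part without distinguishing cases at the origin. *)
Lemma is_derive_quadratic (q : R -> R) (t l : R) :
    (forall h, `|q (h + t) - q t - l * h| <= h ^+ 2) ->
  is_derive t (1 : R) (q : R -> R^o) l.
Proof.
move=> qh.
have L : h^-1 *: ((q (h *: 1 + t) : R^o) - q t) @[h --> 0^'] --> (l : R^o).
  apply/cvgrPdist_le => e e0; near=> h.
  have h0 : h != 0 by near: h; exact: nbhs_dnbhs_neq.
  have -> : l - h^-1 *: (q (h *: 1 + t) - q t) =
      - (h^-1 * (q (h + t) - q t - l * h)).
    by rewrite [h *: 1]mulr1 /GRing.scale/=; field.
  rewrite normrN normrM normfV ler_pdivrMl ?normr_gt0//.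
  apply: (le_trans (qh h)); rewrite -real_normK ?num_real// expr2.
  rewrite ler_wpM2l//; near: h; apply: dnbhs0_le.
  exact: e0.
split; first by apply/cvg_ex; exists l.
exact: cvg_lim L.
Unshelve. all: by end_near. Qed.

Lemma is_derive_sqpos (t : R) : is_derive t (1 : R) (sqpos : R -> R^o) (2 * pospart t).
Proof.
apply: is_derive_quadratic => h; rewrite /sqpos ler_norml.
by case: (pospartP (h + t)) => -[? ->]; case: (pospartP t) => -[? ->];
  apply/andP; split; nra.
Qed.

Lemma is_derive_affine (b c t : R) :
  is_derive t (1 : R) (fun s : R => c * s + b : R) c.
Proof.
apply: is_derive_quadratic => h.
by rewrite [X in `|X|](_ : _ = 0) ?normr0 ?sqr_ge0//; ring.
Qed.

Definition has_C1_derivative (h dh : R -> R) :=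
  (forall s, is_derive s (1 : R) h (dh s)) /\ continuous dh.

Lemma has_C1_derivative_continuous h dh : has_C1_derivative h dh -> continuous h.
Proof.
move=> [dhP _] s; apply: differentiable_continuous; apply/derivable1_diffP.
exact: (@ex_derive _ _ _ _ _ _ _ (dhP s)).
Qed.

Lemma C1_derivative_comp h dh k dk : has_C1_derivative h dh ->
  has_C1_derivative k dk ->
  has_C1_derivative (h \o k) (fun s => dh (k s) * dk s).
Proof.
move=> hC kC; split => [s|s].
  by apply: is_derive1_comp; [exact: hC.1|exact: kC.1].
apply: cvgM; last exact: kC.2.
by apply: continuous_comp; [exact: (has_C1_derivative_continuous kC)|exact: hC.2].
Qed.

Lemma C1_derivative_affine b c : has_C1_derivative (fun s : R => c * s + b) (cst c).
Proof. by split; [move=> s; exact: is_derive_affine|exact: cst_continuous]. Qed.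

Lemma C1_derivative_sqpos : has_C1_derivative sqpos (fun t => 2 * pospart t).
Proof.
split; first exact: is_derive_sqpos.
by move=> t; apply: cvgM; [exact: cvg_cst|exact: continuous_pospart].
Qed.

Lemma C1_derivativeZD (c d : R) h dh k dk : has_C1_derivative h dh ->
  has_C1_derivative k dk ->
  has_C1_derivative (fun s => c * h s + d * k s) (fun s => c * dh s + d * dk s).
Proof.
move=> [hD hC] [kD kC]; split => [s|s].
  exact: (is_deriveD (is_deriveZ c (hD s)) (is_deriveZ d (kD s))).
apply: cvgD.
  by apply: cvgM; [exact: cvg_cst|exact: hC].
by apply: cvgM; [exact: cvg_cst|exact: kC].
Qed.

Lemma C1_derivative_sqr h dh : has_C1_derivative h dh ->
  has_C1_derivative (fun s => h s ^+ 2) (fun s => 2 * h s * dh s).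
Proof.
move=> hC; split => [s|s].
  exact: (is_derive_eq (is_deriveX 2 (hC.1 s))).
apply: cvgM; last exact: hC.2.
by apply: cvgM; [exact: cvg_cst|exact: (has_C1_derivative_continuous hC)].
Qed.

(** Equal to 1 for y <= r and to 0 for y >= 2r, with slope of order 1/r. *)
Definition cutoff (r y : R) : R := sqpos (- sqpos (r^-1 * y - 1) + 1).
Definition dcutoff (r y : R) : R :=
  2 * pospart (- sqpos (r^-1 * y - 1) + 1) * - (2 * pospart (r^-1 * y - 1) * r^-1).

Lemma C1_derivative_cutoff r : has_C1_derivative (cutoff r) (dcutoff r).
Proof.
have h1 := C1_derivative_comp C1_derivative_sqpos (C1_derivative_affine (- 1) r^-1).
have h2 := C1_derivative_comp (C1_derivative_affine 1 (- 1)) h1.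
have [h3 h4] := C1_derivative_comp C1_derivative_sqpos h2.
have E : sqpos \o ((fun s => -1 * s + 1) \o (sqpos \o (fun s => r^-1 * s + -1))) = cutoff r.
  by apply/funext => y; rewrite /cutoff /= mulN1r.
have E' : (fun s => 2 * pospart (((fun s => -1 * s + 1) \o (sqpos \o (fun s => r^-1 * s + -1))) s) *
    (cst (-1) ((sqpos \o (fun s => r^-1 * s + -1)) s) *
     (2 * pospart (r^-1 * s + -1) * cst r^-1 s))) = dcutoff r.
  by apply/funext => y; rewrite /dcutoff /= !mulN1r.
by rewrite -E -E'; split.
Qed.

Lemma cutoff_ge0 r y : 0 <= cutoff r y.
Proof. exact: sqr_ge0. Qed.

Lemma cutoff_le1 r y : cutoff r y <= 1.
Proof.
rewrite /cutoff; set t := _ + 1.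
have t1 : t <= 1 by rewrite /t gerDr oppr_le0 sqr_ge0.
by rewrite /sqpos; case: (pospartP t) => -[? ->]; nra.
Qed.

Lemma cutoff_eq1 r y : 0 < r -> y <= r -> cutoff r y = 1.
Proof.
move=> r0 yr; rewrite /cutoff; have : r^-1 * y - 1 <= 0.
  by rewrite subr_le0 ler_pdivrMl// mulr1.
set t := _ - 1 => t0; have -> : sqpos t = 0.
  by rewrite /sqpos; case: (pospartP t) => -[? ->]; nra.
by rewrite oppr0 add0r /sqpos /pospart max_r// expr1n.
Qed.

Lemma cutoff_large r y : 0 < r -> 2 * r <= y ->
  pospart (- sqpos (r^-1 * y - 1) + 1) = 0.
Proof.
move=> r0 yr; have : 1 <= r^-1 * y - 1.
  by rewrite lerBrDr ler_pdivlMl// mulrC.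
set t := _ - 1 => t1; rewrite /sqpos; case: (pospartP t) => -[? ->]; first lra.
by case: (pospartP (- t ^+ 2 + 1)) => -[? ->] //; nra.
Qed.

Lemma cutoff_eq0 r y : 0 < r -> 2 * r <= y -> cutoff r y = 0.
Proof. by move=> r0 yr; rewrite /cutoff /sqpos cutoff_large// expr0n. Qed.

Lemma dcutoff_eq0 r y : 0 < r -> ~ (r < y < 2 * r) -> dcutoff r y = 0.
Proof.
move=> r0 /negP; rewrite negb_and -!leNgt => /orP[yr|yr].
  rewrite /dcutoff [pospart (r^-1 * y - 1)]max_l ?mulr0 ?mul0r ?oppr0 ?mulr0//.
  by rewrite subr_le0 ler_pdivrMl// mulr1.
by rewrite /dcutoff cutoff_large// mulr0 mul0r.
Qed.

(** With t = y/r - 1, the derivative is -4 p q / r, where q is the positive part of t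
    and p that of 1 - q^2, so that 0 <= p q <= 1. *)
Lemma dcutoff_sqr_le r y : 0 < r -> dcutoff r y ^+ 2 <= 16 * (r ^+ 2)^-1.
Proof.
move=> r0; rewrite /dcutoff; set t := _ - 1.
have : 0 <= pospart (- sqpos t + 1) * pospart t <= 1.
  rewrite mulr_ge0 ?pospart_ge0//=.
  rewrite /sqpos; case: (pospartP t) => -[? ->]; first by rewrite mulr0.
  by case: (pospartP (- t ^+ 2 + 1)) => -[? ->]; nra.
set p := pospart _; set q := pospart _ => pq.
have -> : (2 * p * - (2 * q * r^-1)) ^+ 2 = 16 * (p * q) ^+ 2 * (r ^+ 2)^-1.
  by field; rewrite gt_eqF.
by rewrite ler_wpM2r ?invr_ge0 ?sqr_ge0//; nra.
Qed.

(** A C^1 version of the positive part of s - c: zero before c, quadratic on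
    [c, c + d], and then equal to s - c - d/2, because
    (t^2 - (t - d)^2) / (2d) = t - d/2. *)
Definition ramp (c d s : R) : R :=
  (2 * d)^-1 * sqpos (1 * s - c) + - (2 * d)^-1 * sqpos (1 * s - (c + d)).
Definition dramp (c d s : R) : R := d^-1 * (pospart (s - c) - pospart (s - (c + d))).

Lemma C1_derivative_ramp c d : 0 < d -> has_C1_derivative (ramp c d) (dramp c d).
Proof.
move=> d0.
have h1 := C1_derivative_comp C1_derivative_sqpos (C1_derivative_affine (- c) 1).
have h2 := C1_derivative_comp C1_derivative_sqpos (C1_derivative_affine (- (c + d)) 1).
have [h3 h4] := C1_derivativeZD (2 * d)^-1 (- (2 * d)^-1) h1 h2.
rewrite (_ : dramp c d = fun s => (2 * d)^-1 * (2 * pospart (1 * s - c) * cst 1 s) +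
  - (2 * d)^-1 * (2 * pospart (1 * s - (c + d)) * cst 1 s)); first by split.
by apply/funext => s; rewrite /dramp /= !mul1r; field; rewrite gt_eqF.
Qed.

Lemma dramp_itv c d s : 0 < d -> 0 <= dramp c d s <= 1.
Proof.
move=> d0; rewrite /dramp ler_pdivrMl// mulr1.
rewrite pmulr_rge0 ?invr_gt0//.
by case: (pospartP (s - c)) => -[? ->]; case: (pospartP (s - (c + d))) => -[? ->];
  apply/andP; split; lra.
Qed.

Lemma ramp_le c d s : s <= c -> 0 < d -> ramp c d s = 0.
Proof.
move=> sc d0; rewrite /ramp /sqpos mul1r.
case: (pospartP (s - c)) => -[? ->]; case: (pospartP (s - (c + d))) => -[? ->]; try lra.
by rewrite (_ : s - c = 0) ?expr0n/= ?mulr0 ?addr0//; lra.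
Qed.

(** The second assertion is what makes the ramp useful: s - ramp c d s stays in the
    prescribed interval [c, c + d] for all s > c. *)
Lemma ramp_gt c d s : c < s -> 0 < d -> 0 < ramp c d s /\ c <= s - ramp c d s <= c + d.
Proof.
move=> cs d0; have d20 : 0 < 2 * d by rewrite mulr_gt0.
have -> : ramp c d s = (2 * d)^-1 * (sqpos (s - c) - sqpos (s - (c + d))).
  by rewrite /ramp !mul1r; ring.
set x := sqpos _ - _.
have x0 : 0 < x /\ 2 * d * (s - (c + d)) <= x <= 2 * d * (s - c).
  rewrite /x /sqpos.
  by case: (pospartP (s - c)) => -[? ->]; case: (pospartP (s - (c + d))) => -[? ->];
    split; try (apply/andP; split); nra.
case: x0 => x0 /andP[x1 x2]; split; first by rewrite mulr_gt0 ?invr_gt0.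
by apply/andP; split; [rewrite lerBrDr addrC -lerBrDr ler_pdivrMl//|
  rewrite lerBlDl -lerBlDr ler_pdivlMl//].
Qed.

(** Difference quotients of a convex function at s lie below the slope of the chord,
    whence the weak inequality in the limit; it becomes strict when the weak one is
    applied at the midpoint of s and c, where the chord lies strictly above f. *)
Lemma strictly_convex_tangent (f df : R -> R) (s c : R) :
    strictly_convex f -> is_derive s (1 : R) f (df s) -> s != c ->
  f s + df s * (c - s) < f c.
Proof.
move=> cf dfs.
have weak (e : R) : s != e -> df s * (e - s) <= f e - f s.
  move=> se.
  have dg : is_derive (0 : R) (1 : R) (f \o (fun t : R => (e - s) * t + s)) (df s * (e - s)).
    apply: is_derive1_comp; last exact: is_derive_affine.
    by rewrite mulr0 add0r.
  have := @ex_derive _ _ _ _ _ _ _ dg.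
  have := @derive_val _ _ _ _ _ _ _ dg; rewrite /derive /derivable => <-.
  move=> /cvg_dnbhs_at_right L; apply: (cvgr_to_le L).
  near=> h; have h0 : 0 < h by near: h; exact: nbhs_right_gt.
  rewrite /GRing.scale/= mulr0 add0r mulr1 addr0 ler_pdivrMl//.
  have h1 : h < 1 by near: h; apply: nbhs_right_lt.
  have := cf e s h; rewrite eq_sym se h0 h1 => /(_ isT isT).
  rewrite (_ : h * e + (1 - h) * s = (e - s) * h + s); last by ring.
  lra.
move=> sc; pose m := (s + c) / 2.
have sm : s != m by apply/eqP => smE; move/eqP: sc; apply; rewrite /m in smE; lra.
have := weak m sm.
have := cf s c 2^-1 sc; rewrite invr_gt0 ltr0n invf_lt1 ?ltr0n// ltr1n => /(_ isT).
rewrite (_ : 2^-1 * s + (1 - 2^-1) * c = m); last by rewrite /m; lra.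
rewrite /m; lra.
Unshelve. all: by end_near. Qed.

Lemma le0_of_small (D C : R) : (forall e, 0 < e <= 1 -> D <= C * e) -> D <= 0.
Proof.
move=> DC; apply/ler_addgt0Pr => e e0; rewrite add0r.
have C0 : 0 < `|C| + 1 by rewrite ltr_wpDl.
pose e1 := Num.min 1 (e / (`|C| + 1)).
have e10 : 0 < e1 by rewrite lt_min ltr01 divr_gt0.
apply: (le_trans (DC e1 _)); first by rewrite e10 ge_min lexx.
have : C * e1 <= (`|C| + 1) * e1.
  by rewrite ler_wpM2r// ?(ltW e10)// (le_trans (ler_norm _))// lerDl.
move=> h; apply: (le_trans h); rewrite mulrC -ler_pdivlMr//.
by rewrite ge_min lexx orbT.
Qed.

End one_variable.

(** * Gradients along the axes *)

Section chain_rule.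
Context {R : realType} {V : normedModType R}.

Lemma is_derive_lineP (F : V -> R) (X v : V) (d : R) :
  is_derive X v F d <-> is_derive (0 : R) (1 : R) (fun s : R => F (s *: v + X)) d.
Proof.
set G := fun s : R => _.
have E : (fun h : R => h^-1 *: (G (h *: 1 + 0) - G 0)) =
    (fun h : R => h^-1 *: (F (h *: v + X) - F X)).
  by apply/funext => h; rewrite /G addr0 [h *: 1]mulr1 scale0r add0r.
split=> -[d1 d2]; split.
- by rewrite /derivable E.
- by rewrite /derive E.
- by rewrite /derivable -E.
- by rewrite /derive -E.
Qed.

Lemma is_derive_comp_real (F : V -> R) (h : R -> R) (X v : V) (dF dh : R) :
  is_derive X v F dF -> is_derive (F X) (1 : R) h dh ->
  is_derive X v (h \o F) (dh * dF).
Proof.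
move=> /is_derive_lineP dFX dhF; apply/is_derive_lineP.
by apply: (@is_derive1_comp R h (fun s : R => F (s *: v + X))) => //;
  rewrite scale0r add0r.
Qed.

End chain_rule.

Section dot_product.
Context {R : realType} {m : nat}.
Implicit Types x y z : 'rV[R]_m.

Lemma dotpC x y : dotp x y = dotp y x.
Proof. by apply: eq_bigr => i _; rewrite mulrC. Qed.

Lemma dotpDl x y z : dotp (x + y) z = dotp x z + dotp y z.
Proof. by rewrite /dotp -big_split; apply: eq_bigr => i _; rewrite mxE mulrDl. Qed.

Lemma dotpZl (c : R) x z : dotp (c *: x) z = c * dotp x z.
Proof. by rewrite /dotp mulr_sumr; apply: eq_bigr => i _; rewrite mxE mulrA. Qed.

Lemma dotpDr x y z : dotp z (x + y) = dotp z x + dotp z y.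
Proof. by rewrite dotpC dotpDl !(dotpC _ z). Qed.

Lemma dotpZr (c : R) x z : dotp z (c *: x) = c * dotp z x.
Proof. by rewrite dotpC dotpZl dotpC. Qed.

Lemma dotp_ge0 x : 0 <= dotp x x.
Proof. by apply: sumr_ge0 => i _; rewrite -expr2 sqr_ge0. Qed.

Lemma enorm_sqr x : enorm x ^+ 2 = dotp x x.
Proof. by rewrite sqr_sqrtr// dotp_ge0. Qed.

Lemma continuous_enorm (T : topologicalType) (G : T -> 'rV[R]_m) (X : T) :
  (forall i, {for X, continuous (fun Y => G Y ord0 i)}) ->
  {for X, continuous (fun Y => enorm (G Y))}.
Proof.
move=> cG; apply: (@continuous_comp _ _ _ (fun Y => dotp (G Y) (G Y)) Num.sqrt).
  by apply: cvg_big => [|i _]; [exact: add_continuous|by apply: cvgM; exact: cG].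
exact: sqrt_continuous.
Qed.

End dot_product.

Section axes.
Context {R : realType} {n : nat}.

(** The unit vector of the y axis, in the indexing of coordinates used by the gradient. *)
Definition vertical : 'rV[R]_(n + 1) := \row_k (axis k : 'rV[R]_n * R).2.

Lemma vertical_lshift i : vertical ord0 (lshift 1 i) = 0.
Proof. by rewrite mxE /axis (unsplitK (inl i)). Qed.

Lemma vertical_rshift i : vertical ord0 (rshift n i) = 1.
Proof. by rewrite mxE /axis (unsplitK (inr i)). Qed.

Lemma dotp_vertical (x : 'rV[R]_(n + 1)) : dotp x vertical = x ord0 (rshift n ord0).
Proof.
rewrite /dotp big_split_ord /= big1 ?add0r => [|i _]; last first.
  by rewrite vertical_lshift mulr0.
by rewrite big_ord1 vertical_rshift mulr1.
Qed.

Lemma dotp_vertical_vertical : dotp vertical vertical = 1.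
Proof. by rewrite dotp_vertical vertical_rshift. Qed.

(** The left-hand side is the square of one coordinate of x. *)
Lemma dotp_vertical_le (x : 'rV[R]_(n + 1)) : dotp x vertical ^+ 2 <= dotp x x.
Proof.
rewrite dotp_vertical /dotp (bigD1 (rshift n ord0))//= -expr2 lerDl.
by apply: sumr_ge0 => i _; rewrite -expr2 sqr_ge0.
Qed.

End axes.

(** * Test functions of the form h(u) sigma(y) *)

Lemma cvge0_squeeze {R : realType} {T : Type} (F : set_system T) {FF : Filter F}
    (V : T -> \bar R) :
    (forall e : R, 0 < e -> \forall t \near F, (0 <= V t <= e%:E)%E) ->
  V t @[t --> F] --> 0%E.
Proof.
move=> VF; apply/fine_cvgP; split.
  have := VF 1 ltr01; apply: filterS => t /andP[V0 V1].
  by rewrite ge0_fin_numE//; apply: le_lt_trans V1 (ltry _).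
apply/cvgr0Pnorm_le => e e0; have := VF e e0; apply: filterS => t /andP[V0 V1] /=.
rewrite ger0_norm ?fine_ge0//.
have Vf : V t \is a fin_num by rewrite ge0_fin_numE//; apply: le_lt_trans V1 (ltry _).
by rewrite -lee_fin fineK.
Qed.

Lemma integrable_comp_bounded {R : realType} {n : nat} (Om : set 'rV[R]_n) (M : R)
    (V : 'rV[R]_n -> R) (k : R -> R) :
    open Om -> bounded_set Om -> (forall x, Om x -> {for x, continuous V}) ->
    (forall x, Om x -> `|V x| <= M) -> continuous k ->
  (lebesgue_rV R n).-integrable Om (EFin \o (k \o V)).
Proof.
move=> oOm bOm V_cont V_bound ck.
have [H hH] := compact_bound (@segment_compact R (- M) M) (fun s _ => ck s).
have mOm := open_measurable_rV oOm.
apply: (@integrable_bounded_support _ _ _ (lebesgue_rV R n) Om Om H) => //.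
- exact: lebesgue_rV_bounded.
- apply: continuous_measurable_rV => // x Ox.
  by apply: continuous_comp; [exact: V_cont|exact: ck].
- by move=> x Ox _; apply: hH; rewrite /= in_itv/= -ler_norml; exact: V_bound.
Qed.

Section test_functions.
Context {R : realType} {n : nat}.
Local Notation point := ('rV[R]_n * R)%type.
Local Notation mpoint := ('rV[R]_n * measurableTypeR R)%type.
Local Notation mu := (lebesgue_xy R n).
Local Notation mux := (lebesgue_rV R n).
Variables (Om : set 'rV[R]_n) (a : R -> R -> R) (u : point -> R).
Hypotheses (oOm : open Om) (bOm : bounded_set Om).
Hypothesis a_cont : {within [set p : R^o * R^o | 0 < p.1 /\ 0 <= p.2],
  continuous (fun p => a p.1 p.2 : R^o)}.
Hypothesis a_gt0 : forall y t, 0 < y -> 0 <= t -> 0 < a y t.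
Hypothesis u_cont : {within cyl_closed Om, continuous u}.
Hypothesis u_C2 : Ck (cyl Om) 2 (u : point -> R^o).
Variable M : R.
Hypothesis uM : forall X, cyl Om X -> `|u X| <= M.
Hypothesis energy : mu.-integrable (cyl Om)
  (fun X => (weight a u X * enorm (grad u X) ^+ 2)%:E).

Lemma open_cyl : open (cyl Om).
Proof.
have -> : cyl Om = (fst @^-1` Om) `&` ((snd : point -> R) @^-1` [set y | 0 < y]).
  by apply/seteqP; split => -[].
apply: openI.
  by apply: open_comp => // X _; exact: cvg_fst.
by apply: open_comp => [X _|]; [exact: cvg_snd|exact: open_gt].
Qed.

Lemma measurable_Om : measurable Om.
Proof. exact: open_measurable_rV. Qed.

Lemma measurable_cyl : measurable (cyl Om : set mpoint).
Proof. by apply: open_measurable_xy; exact: open_cyl. Qed.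

Lemma Om_fin : (mux Om < +oo)%E.
Proof. by apply: lebesgue_rV_bounded => //; exact: measurable_Om. Qed.

Lemma u_is_derive X v : cyl Om X -> is_derive X v u ('D_v u X).
Proof. by move=> CX; apply: derivableP; apply: ((u_C2 (vs := [::])) isT).2. Qed.

Lemma u_continuous X : cyl Om X -> {for X, continuous u}.
Proof. by move=> CX; exact: ((u_C2 (vs := [::])) isT).1. Qed.

Lemma Du_continuous X v : cyl Om X -> {for X, continuous ('D_v u)}.
Proof. by move=> CX; exact: ((u_C2 (vs := [:: v])) isT).1. Qed.

Lemma grad_continuous X k : cyl Om X -> {for X, continuous (fun Y => grad u Y ord0 k)}.
Proof.
move=> CX; rewrite (_ : (fun Y => _) = 'D_(axis k) u); first exact: Du_continuous.
by apply/funext => Y; rewrite mxE.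
Qed.

Lemma weight_gt0 X : cyl Om X -> 0 < weight a u X.
Proof. by move=> [_ y0]; apply: a_gt0 => //; exact: sqrtr_ge0. Qed.

Lemma weight_continuous X : cyl Om X -> {for X, continuous (weight a u)}.
Proof.
move=> CX; have [_ y0] := CX.
move/subspace_continuousP : a_cont => /(_ (X.2, enorm (grad u X))) /= ac.
have {}ac := ac (conj y0 (sqrtr_ge0 _)).
refine (@cvg_comp _ _ _ (fun Y : point => (Y.2, enorm (grad u Y)) : R^o * R^o)
  (fun p : R^o * R^o => a p.1 p.2 : R^o) _ _ _ _ ac).
move=> A [[B1 B2] [B21 B22] B12].
change (\near X, A (X.2, enorm (grad u X))).
have c2 : (snd : point -> R) Y @[Y --> X] --> X.2 by exact: cvg_snd.
have cg : {for X, continuous (fun Y => enorm (grad u Y))}.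
  by apply: continuous_enorm => i; exact: grad_continuous.
have o1 : \near X, cyl Om X by apply: open_nbhs_nbhs; split => //; exact: open_cyl.
near=> Y; apply: (B12 (Y.2, enorm (grad u Y))).
  by split => /=; near: Y; [exact: c2|exact: cg].
have [_ Y0] : cyl Om Y by near: Y.
by split => //=; exact: sqrtr_ge0.
Unshelve. all: by end_near. Qed.

Lemma continuous_comp_u (k : R -> R) : continuous k -> forall X, cyl Om X ->
  {for X, continuous (k \o u)}.
Proof.
by move=> ck X CX; apply: continuous_comp; [exact: u_continuous|exact: ck].
Qed.

Lemma continuous_comp_y (k : R -> R) : continuous k -> forall X : point,
  {for X, continuous (fun X : point => k X.2)}.
Proof.
by move=> ck X; apply: (@continuous_comp _ _ _ snd k); [exact: cvg_snd|exact: ck].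
Qed.

(** The gradient of h(u(X)) sigma(y), by the product and chain rules. *)
Definition dtest (h dh sigma dsigma : R -> R) (X : point) : 'rV[R]_(n + 1) :=
  (dh (u X) * sigma X.2) *: grad u X + (h (u X) * dsigma X.2) *: vertical.

Section one_test_function.
Variables (h dh sigma dsigma : R -> R).
Hypotheses (hC : has_C1_derivative h dh) (sC : has_C1_derivative sigma dsigma).

Let test (X : point) : R := h (u X) * sigma X.2.
Let G := dtest h dh sigma dsigma.

Lemma test_is_derive X k : cyl Om X -> is_derive X (axis k) test (G X ord0 k).
Proof.
move=> CX.
have d1 : is_derive X (axis k) (h \o u) (dh (u X) * 'D_(axis k) u X).
  by apply: is_derive_comp_real; [exact: u_is_derive|exact: hC.1].
have d2 : is_derive X (axis k : point) (sigma \o snd) (dsigma X.2 * (axis k : point).2).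
  apply: is_derive_comp_real; last exact: sC.1.
  apply/is_derive_lineP; apply: is_derive_quadratic => t.
  rewrite [X in `|X|](_ : _ = 0) ?normr0 ?sqr_ge0//=.
  by rewrite /GRing.scale/=; ring.
refine (@is_derive_eq _ _ _ test X _ _ _ (is_deriveM d1 d2) _).
by rewrite /G /dtest !mxE /GRing.scale/=; ring.
Qed.

Lemma test_continuous X : cyl Om X -> {for X, continuous test}.
Proof.
move=> CX; apply: cvgM.
  exact: (continuous_comp_u (has_C1_derivative_continuous hC)).
exact: (continuous_comp_y (has_C1_derivative_continuous sC)).
Qed.

Lemma dtest_continuous X k : cyl Om X -> {for X, continuous (fun Y => G Y ord0 k)}.
Proof.
move=> CX.
rewrite (_ : (fun Y => _) = fun Y => dh (u Y) * sigma Y.2 * 'D_(axis k) u Y +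
    h (u Y) * dsigma Y.2 * vertical ord0 k); last first.
  by apply/funext => Y; rewrite !mxE.
apply: cvgD; apply: cvgM.
- apply: cvgM; first exact: (continuous_comp_u hC.2).
  exact: (continuous_comp_y (has_C1_derivative_continuous sC)).
- exact: Du_continuous.
- apply: cvgM; last exact: (continuous_comp_y sC.2).
  exact: (continuous_comp_u (has_C1_derivative_continuous hC)).
- exact: cvg_cst.
Qed.

Lemma test_W11 : W11_loc (cyl Om) test G.
Proof.
move=> k; apply: (@C1_weak_derivative R n (cyl Om) (axis k) test (fun X => G X ord0 k)).
- exact: open_cyl.
- exact: test_continuous.
- by move=> X; exact: test_is_derive.
- by move=> X; exact: dtest_continuous.
Qed.


Hypotheses (s0 : sigma 0 = 1) (s01 : forall y, 0 <= sigma y <= 1).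
Hypothesis sN : exists N, forall y, N <= y -> sigma y = 0.
Hypothesis ds_int : mu.-integrable (cyl Om) (fun X => (weight a u X * dsigma X.2 ^+ 2)%:E).

Let bottom (x : 'rV[R]_n) : R := h (u (x, 0)).

Let cyl_closed0 (x : 'rV[R]_n) y : Om x -> 0 <= y -> cyl_closed Om (x, y).
Proof. by move=> Ox y0; split => //; exact: subset_closure. Qed.

Let u_cvg (T : Type) (F : set_system T) {FF : Filter F} (p : T -> point) (X : point) :
  cyl_closed Om X -> (\forall t \near F, cyl_closed Om (p t)) ->
  p t @[t --> F] --> X -> u (p t) @[t --> F] --> u X.
Proof.
move=> CX Cp pX; move/subspace_continuousP : u_cont => /(_ X CX) uX.
apply: (cvg_comp _ _ _ uX) => A XA.
have : \forall t \near F, (cyl_closed Om (p t) -> A (p t)) by exact: pX XA.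
by move=> /(filterI Cp); apply: filterS => t [C]; exact.
Qed.

Lemma u_bottom_continuous x : Om x -> {for x, continuous (fun x => u (x, 0))}.
Proof.
move=> Ox; apply: (@u_cvg _ (nbhs x) _ (fun z => (z, 0)) (x, 0)).
- exact: cyl_closed0.
- have : \near x, Om x by exact: open_nbhs_nbhs.
  by apply: filterS => z Oz; exact: cyl_closed0.
- exact: (@cvg_pair _ _ _ (nbhs x) (nbhs x) (nbhs (0 : R)) _ _ _ id (cst 0) cvg_id (cvg_cst _)).
Qed.

Lemma u_bottom_bounded x : Om x -> `|u (x, 0)| <= M.
Proof.
move=> Ox.
have ux : u (x, y) @[y --> 0^'+] --> u (x, 0).
  apply: (@u_cvg _ (0^'+) _ (fun y => (x, y)) (x, 0)).
  - exact: cyl_closed0.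
  - have : \forall y \near 0^'+, (0 : R) < y by exact: nbhs_right_gt.
    by apply: filterS => y y0; apply: cyl_closed0 => //; exact: ltW.
  - exact: (@cvg_pair _ _ _ (0^'+) (nbhs x) (nbhs (0 : R)) _ _ _ (cst x) id (cvg_cst _) (cvg_within _)).
apply: (cvgr_to_le (cvg_norm ux)); near=> y.
by apply: uM; split => //=.
Unshelve. all: by end_near. Qed.

Let bottom_continuous x : Om x -> {for x, continuous bottom}.
Proof.
move=> Ox; apply: (@continuous_comp _ _ _ (fun x => u (x, 0)) h).
  exact: u_bottom_continuous.
exact: (has_C1_derivative_continuous hC).
Qed.

Lemma C1_bounded : exists2 H : R, 0 <= H &
  forall s, `|s| <= M -> `|h s| <= H /\ `|dh s| <= H.
Proof.
have [H1 hH1] := compact_bound (@segment_compact R (- M) M)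
  (fun s _ => @has_C1_derivative_continuous _ _ _ hC s).
have [H2 hH2] := compact_bound (@segment_compact R (- M) M) (fun s _ => hC.2 s).
exists (Num.max 0 (Num.max H1 H2)); first by rewrite le_max lexx.
move=> s sM; have sMM : `[- M, M]%classic s.
  by rewrite /= in_itv/= -ler_norml.
by split; rewrite !le_max; apply/orP; right; apply/orP; [left; exact: hH1|right; exact: hH2].
Qed.

(** Each point (x, 0) has a neighbourhood on which the test function is nearly equal to
    its value there; compactness of K makes the height of these neighbourhoods
    uniform. *)
Lemma test_trace_uniform K (e : R) : compact K -> K `<=` Om -> 0 < e ->
  \forall r \near 0^'+, forall X, slab K 0 r X -> `|test X - bottom X.1| <= e.
Proof.
move=> cK KO e0.
have /compact_near_coveringP cov := cK.
pose P (r : R) (x : 'rV[R]_n) := Om x ->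
  forall y, 0 < y < r -> `|test (x, y) - bottom x| <= e.
have testE x : test (x, 0) = bottom x by rewrite /test /bottom s0 mulr1.
have : \forall r \near 0^'+, K `<=` P r.
  apply: cov => x Kx.
  have tx : test Y @[Y --> within (cyl_closed Om) (nbhs (x, 0 : R))] --> test (x, 0).
    apply: cvgM.
      apply: continuous_cvg; first exact: (has_C1_derivative_continuous hC).
      move/subspace_continuousP : u_cont; apply; apply: cyl_closed0 => //.
      exact: KO.
    apply: continuous_cvg; first exact: (has_C1_derivative_continuous sC).
    by apply: cvg_within_filter; exact: cvg_snd.
  have e20 : 0 < e / 2 by rewrite divr_gt0.
  move/cvgrPdist_lt : tx => /(_ _ e20).
  rewrite /prop_near1 /within/= => /nbhs_ballP[r /= r0 rP].
  exists (ball x r, [set y | y < r]) => /=.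
    split; first exact: nbhsx_ballx.
    by apply: nbhs_right_lt.
  move=> [x' r'] /= [xx' r'r] Ox' y /andP[y0 yr'].
  have B1 : ball (x, 0 : R) r (x', y).
    by split => //=; rewrite -ball_normE /ball_/= sub0r normrN gtr0_norm// (lt_trans yr').
  have B2 : ball (x, 0 : R) r (x', 0) by split => //=; exact: ballxx.
  have := rP _ B1 (cyl_closed0 Ox' (ltW y0)).
  have := rP _ B2 (cyl_closed0 Ox' (lexx _)).
  rewrite !testE => d1 d2.
  rewrite (splitr e) (le_trans (ler_distD (bottom x) _ _))// lerD// ltW//.
  by rewrite distrC.
apply: filterS => r KP [x y] [Kx yr]; exact: (KP x Kx (KO _ Kx)).
Qed.

Lemma test_has_trace : has_trace Om test bottom.
Proof.
move=> K cK KO.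
have mK := compact_measurable_rV cK.
have mOm : measurable Om by exact: measurable_Om.
have Kfin : (mux K < +oo)%E.
  by apply: le_lt_trans Om_fin; apply: le_measure; rewrite ?inE.
have [m m0 mE] : exists2 m : R, 0 <= m & mux K = m%:E.
  exists (fine (mux K)); first exact: fine_ge0.
  by rewrite fineK// ge0_fin_numE.
apply: cvge0_squeeze => e e0.
have e'0 : 0 < e / (m + 1) by rewrite divr_gt0// ltr_wpDl.
have unif := test_trace_uniform cK KO e'0.
near=> r.
have r0 : 0 < r by near: r; exact: nbhs_right_gt.
have unif_r X : slab K 0 r X -> `|test X - bottom X.1| <= e / (m + 1).
  by move: X; near: r; exact: unif.
have slabE : slab K 0 r = K `*` `]0, r[%classic.
  by apply/seteqP; split => -[x y] /=; rewrite in_itv.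
have mS : measurable (slab K 0 r : set mpoint).
  by rewrite slabE; apply: measurableX => //; exact: measurable_itv.
have muS : mu (slab K 0 r) = (m * r)%:E.
  rewrite slabE [LHS](lebesgue_xyX mK (measurable_itv `]0, r[)) mE.
  by rewrite [X in (_ * X)%E](lebesgue_measure_itv `]0, r[)/= lte_fin r0 oppr0 adde0 EFinM.
apply/andP; split.
  apply: mule_ge0; first by rewrite lee_fin invr_ge0 ltW.
  by apply: integral_ge0 => X _; rewrite lee_fin.
have SC : slab K 0 r `<=` cyl Om by move=> [x y] [Kx /andP[y0 _]]; split => //=; exact: KO.
have mW : measurable_fun (slab K 0 r : set mpoint) (fun X => (test X - bottom X.1)%:E).
  apply/measurable_EFinP; apply: (@measurable_funS _ _ mpoint _ (cyl Om)) => //.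
    exact: measurable_cyl.
  apply: continuous_measurable_xy; first exact: open_cyl.
  move=> X CX; apply: cvgB; first exact: test_continuous.
  apply: (@continuous_comp _ _ _ fst bottom); first exact: cvg_fst.
  by apply: bottom_continuous; case: CX.
have := @integral_le_bound _ mpoint R mu (slab K 0 r) _ (e / (m + 1))%:E mS mW.
rewrite lee_fin => /(_ (ltW e'0)) bound.
apply: (@le_trans _ _ ((r^-1)%:E * ((e / (m + 1))%:E * mu (slab K 0 r)))%E).
  apply: lee_wpmul2l; first by rewrite lee_fin invr_ge0 ltW.
  apply: bound; apply: aeW => X SX; rewrite lee_fin; exact: unif_r.
rewrite muS -!EFinM lee_fin.
have -> : r^-1 * (e / (m + 1) * (m * r)) = e * (m / (m + 1)).
  by field; rewrite ?gt_eqF// ltr_wpDl.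
apply: ler_piMr; first exact: ltW.
by rewrite ler_pdivrMr ?ltr_wpDl// mul1r lerDl.
Unshelve. all: by end_near. Qed.

Lemma bottom_L2 : L2 Om bottom.
Proof.
have mb : measurable_fun Om bottom by exact: continuous_measurable_rV.
split => //; have [H H0 hH] := C1_bounded.
apply: (@integrable_bounded_support _ _ _ mux Om Om (H ^+ 2)) => //.
- exact: measurable_Om.
- exact: measurable_Om.
- exact: Om_fin.
- exact: measurable_funX.
- move=> x Ox _; have [bH _] := hH _ (u_bottom_bounded Ox).
  by rewrite normrX ler_sqr ?nnegrE// (le_trans _ bH).
Qed.

Lemma dotp_dtest X : dotp (G X) (G X) =
  (dh (u X) * sigma X.2) ^+ 2 * dotp (grad u X) (grad u X) +
  2 * (dh (u X) * sigma X.2) * (h (u X) * dsigma X.2) * dotp (grad u X) vertical +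
  (h (u X) * dsigma X.2) ^+ 2.
Proof.
rewrite /G /dtest !(dotpDl, dotpDr, dotpZl, dotpZr) dotp_vertical_vertical.
by rewrite [dotp vertical _]dotpC; ring.
Qed.

(** Expanding the square, the energy density of the test function is at most
    2 H^2 (w |grad u|^2 + w sigma'^2), where H bounds h and h' on the range of u. *)
Lemma weight_dtest_integrable :
  mu.-integrable (cyl Om) (fun X => (weight a u X * enorm (G X) ^+ 2)%:E).
Proof.
have [H H0 hH] := C1_bounded.
have mC := measurable_cyl.
have i1 := integrableZl mC (2 * H ^+ 2) energy.
have i2 := integrableZl mC (2 * H ^+ 2) ds_int.
have := integrableD mC i1 i2; apply: le_integrable => //.
  apply/measurable_EFinP; apply: continuous_measurable_xy; first exact: open_cyl.
  move=> X CX; apply: cvgM; first exact: weight_continuous.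
  apply: (@continuous_comp _ _ _ (fun Y => enorm (G Y)) (fun s => s ^+ 2)).
    by apply: continuous_enorm => i; exact: dtest_continuous.
  exact: exprn_continuous.
move=> X CX; rewrite /= lee_fin.
have w0 := weight_gt0 CX.
rewrite !enorm_sqr ger0_norm; last by rewrite mulr_ge0 ?dotp_ge0//; exact: ltW.
apply: le_trans (ler_norm _).
rewrite dotp_dtest.
have [hb dhb] := hH _ (uM CX).
have [s_ge0 s_le1] := andP (s01 X.2).
have := dotp_vertical_le (grad u X); have := dotp_ge0 (grad u X).
set g2 := dotp (grad u X) (grad u X); set p := dotp _ vertical.
move=> g0 pg.
set al := dh (u X) * sigma X.2; set be := h (u X) * dsigma X.2.
have al2 : al ^+ 2 <= H ^+ 2.
  rewrite -real_normK ?num_real// ler_sqr ?nnegrE// normrM (ger0_norm s_ge0).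
  by apply: le_trans dhb; rewrite ler_piMr.
have be2 : be ^+ 2 <= H ^+ 2 * dsigma X.2 ^+ 2.
  rewrite exprMn ler_wpM2r ?sqr_ge0// -real_normK ?num_real//.
  by rewrite ler_sqr ?nnegrE.
have E1 : 2 * al * be * p <= al ^+ 2 * g2 + be ^+ 2.
  by have : 0 <= (al * p - be) ^+ 2 by [exact: sqr_ge0]; nra.
have E2 : al ^+ 2 * g2 <= H ^+ 2 * g2 by rewrite ler_wpM2r.
set ds := dsigma X.2 in be2 *.
rewrite (_ : 2 * H ^+ 2 * (_ * g2) + _ = weight a u X * (2 * (H ^+ 2 * g2) + 2 * (H ^+ 2 * ds ^+ 2))); last by ring.
by apply: ler_wpM2l; [exact: ltW|lra].
Qed.

Lemma test_admissible : admissible Om a u test G bottom.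
Proof.
split.
- exact: test_W11.
- by have [N NP] := sN; exists N => X _ /NP sX; rewrite /test sX mulr0.
- exact: weight_dtest_integrable.
- by split; [exact: test_has_trace|exact: bottom_L2].
Qed.

End one_test_function.

(** * The weak equation and stability, tested with cutoffs *)

Hypothesis growth :
  (((r ^+ 2)^-1)%:E *
     \int[mu]_(X in slab Om r (2 * r)) (weight a u X)%:E)%E @[r --> +oo] --> 0%E.

(** The derivative of the cutoff is of order 1/r and lives in the slab r < y < 2r, so
    the growth hypothesis makes its weighted square integral arbitrarily small. *)
Lemma growth_cutoff (e r0 : R) : 0 < e -> exists r, [/\ 0 < r, r0 <= r,
  mu.-integrable (cyl Om) (fun X => (weight a u X * dcutoff r X.2 ^+ 2)%:E) &
  (\int[mu]_(X in cyl Om) (weight a u X * dcutoff r X.2 ^+ 2)%:E <= e%:E)%E].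
Proof.
move=> e0; have e160 : 0 < e / 16 by rewrite divr_gt0.
move/fine_cvgP : growth => [gfin /cvgrPdist_le /(_ _ e160) gle].
have [r [rfin rle r_gt0 r_ge]] : exists r, [/\
    (((r ^+ 2)^-1)%:E * \int[mu]_(X in slab Om r (2 * r)) (weight a u X)%:E)%E
      \is a fin_num,
    `|0 - fine (((r ^+ 2)^-1)%:E *
       \int[mu]_(X in slab Om r (2 * r)) (weight a u X)%:E)%E| <= e / 16,
    0 < r & r0 <= r].
  near (pinfty_nbhs R) => r; exists r; split; near: r.
  - exact: gfin.
  - exact: gle.
  - by apply: nbhs_pinfty_gt; exact: num_real.
  - by apply: nbhs_pinfty_ge; exact: num_real.
have SC : slab Om r (2 * r) `<=` cyl Om.
  by move=> [x y] [Ox /andP[ry _]]; split => //=; exact: lt_trans ry.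
have mS : measurable (slab Om r (2 * r) : set mpoint).
  rewrite (_ : slab _ _ _ = Om `*` `]r, (2 * r)[%classic); last first.
    by apply/seteqP; split => -[x y] /=; rewrite in_itv.
  by apply: measurableX; [exact: measurable_Om|exact: measurable_itv].
have mw : measurable_fun (cyl Om : set mpoint) (weight a u).
  by apply: continuous_measurable_xy; [exact: open_cyl|exact: weight_continuous].
pose W X := weight a u X * dcutoff r X.2 ^+ 2.
have W0 X : cyl Om X -> 0 <= W X.
  by move=> CX; rewrite mulr_ge0 ?sqr_ge0// ltW// weight_gt0.
have mW : measurable_fun (cyl Om : set mpoint) W.
  apply: continuous_measurable_xy; first exact: open_cyl.
  move=> X CX; apply: cvgM; first exact: weight_continuous.
  apply: (@continuous_comp _ _ _ (fun Y : point => dcutoff r Y.2) (fun s => s ^+ 2)).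
    apply: (@continuous_comp _ _ _ snd (dcutoff r)); first exact: cvg_snd.
    exact: (C1_derivative_cutoff r).2.
  exact: exprn_continuous.
have bound : (\int[mu]_(X in cyl Om) (W X)%:E <= e%:E)%E.
  have -> : (\int[mu]_(X in cyl Om) (W X)%:E =
      \int[mu]_(X in slab Om r (2 * r)) (W X)%:E)%E.
    rewrite integral_mkcond [RHS]integral_mkcond; apply: eq_integral => X _.
    rewrite /patch; case: ifPn => XC; case: ifPn => XS //.
      rewrite /W dcutoff_eq0 ?expr0n ?mulr0// => rX.
      move: XS; rewrite notin_setE; apply; split => //.
      by move/set_mem : XC => -[].
    by move: XC; rewrite notin_setE => -[]; apply: SC; exact: set_mem.
  apply: (@le_trans _ _ (\int[mu]_(X in slab Om r (2 * r))
     ((16 * (r ^+ 2)^-1)%:E * (weight a u X)%:E))%E).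
    apply: ge0_le_integral => //.
    - by move=> X /SC CX; rewrite lee_fin W0.
    - by apply/measurable_EFinP; apply: measurable_funS mW => //; exact: measurable_cyl.
    - apply/measurable_EFinP; apply: measurable_funM => //.
      by apply: measurable_funS mw => //; exact: measurable_cyl.
    - move=> X /SC CX; rewrite -EFinM lee_fin /W mulrC ler_wpM2r//.
        by rewrite ltW// weight_gt0.
      exact: dcutoff_sqr_le.
  rewrite ge0_integralZl//; last 3 first.
  - apply/measurable_EFinP.
    by apply: measurable_funS mw => //; exact: measurable_cyl.
  - by move=> X /SC CX; rewrite lee_fin ltW// weight_gt0.
  - by rewrite lee_fin mulr_ge0// invr_ge0 sqr_ge0.
  rewrite EFinM -muleA -(fineK rfin) -EFinM lee_fin.
  by move: rle; rewrite sub0r normrN ler_norml => /andP[_]; lra.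
exists r; split => //; apply/integrableP; split; first exact/measurable_EFinP.
apply: le_lt_trans (ltry e); apply: le_trans bound.
apply: ge0_le_integral => //; first exact: measurable_cyl.
- by apply: measurableT_comp => //; exact/measurable_EFinP.
- exact/measurable_EFinP.
- by move=> X CX; rewrite lee_fin ger0_norm// W0.
Unshelve. all: by end_near. Qed.

Lemma dotp_Bmat (y : R) (eta z : 'rV[R]_(n + 1)) :
  dotp (z *m (Bmat a y eta)^T) z = a y (enorm eta) * dotp z z +
    derive1 (a y : R -> R^o) (enorm eta) / enorm eta * dotp eta z ^+ 2.
Proof.
set c := _ / _.
have E j : (z *m (Bmat a y eta)^T) ord0 j =
    a y (enorm eta) * z ord0 j + c * dotp eta z * eta ord0 j.
  rewrite !mxE.
  rewrite (eq_bigr (fun i => a y (enorm eta) * (z ord0 i * (j == i)%:R) +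
      c * eta ord0 j * (eta ord0 i * z ord0 i))); last first.
    by move=> i _; rewrite !mxE -/c; ring.
  rewrite big_split/= -!mulr_sumr -/(dotp eta z); congr (_ * _ + _); last by ring.
  rewrite (bigD1 j)//= eqxx mulr1 big1 ?addr0// => i ij.
  by rewrite eq_sym (negbTE ij) mulr0.
rewrite {1}/dotp (eq_bigr (fun i => a y (enorm eta) * (z ord0 i * z ord0 i) +
    c * dotp eta z * (eta ord0 i * z ord0 i))); last first.
  by move=> i _; rewrite E; ring.
by rewrite big_split/= -!mulr_sumr -/(dotp eta z) -/(dotp z z) expr2; ring.
Qed.

Variables (f : R -> R) (g : R -> R -> R).
Hypothesis g0 : forall y s : R, 0 < y -> g y s = 0.
Hypothesis a_decr : forall y t : R, 0 < y -> 0 < t -> derive1 (a y : R -> R^o) t <= 0.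
Hypothesis u_weak : weak_equation Om a g f u.
Hypothesis u_stable : stable Om a g f u.
Hypothesis fC : has_C1_derivative f (derive1 (f : R -> R^o)).

(** The correction to the scalar matrix is a_t / |eta| times a square, hence
    nonpositive; it is zero for eta = 0 since then the quotient is zero. *)
Lemma dotp_Bmat_le (y : R) (eta z : 'rV[R]_(n + 1)) : 0 < y ->
  dotp (z *m (Bmat a y eta)^T) z <= a y (enorm eta) * dotp z z.
Proof.
move=> y0; rewrite dotp_Bmat gerDl.
have := sqrtr_ge0 (dotp eta eta); rewrite -/(enorm eta) le_eqVlt => /predU1P[<-|e0].
  by rewrite invr0 mulr0 mul0r.
by rewrite mulr_le0_ge0 ?sqr_ge0// mulr_le0_ge0 ?invr_ge0 ?a_decr// ltW.
Qed.

Lemma integrable_bottom (k : R -> R) : continuous k ->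
  mux.-integrable Om (fun x => (k (u (x, 0)))%:E).
Proof.
apply: (@integrable_comp_bounded _ _ Om M (fun x => u (x, 0))) => // x Ox.
  exact: u_bottom_continuous.
exact: u_bottom_bounded.
Qed.

Section one_cutoff.
Variable r : R.
Hypothesis r_gt0 : 0 < r.
Hypothesis cut_int : mu.-integrable (cyl Om)
  (fun X => (weight a u X * dcutoff r X.2 ^+ 2)%:E).

Let w X := weight a u X.
Let g2 X := dotp (grad u X) (grad u X).
Let p X := dotp (grad u X) vertical.
Let tau (X : point) := cutoff r X.2.
Let dtau (X : point) := dcutoff r X.2.

Lemma energy_dotp : mu.-integrable (cyl Om) (fun X => (w X * g2 X)%:E).
Proof.
apply: eq_integrable energy; first exact: measurable_cyl.
by move=> X _; rewrite enorm_sqr.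
Qed.

Lemma dotp_grad_continuous X : cyl Om X -> {for X, continuous g2}.
Proof.
move=> CX; apply: cvg_big => [|i _]; first exact: add_continuous.
by apply: cvgM; exact: grad_continuous.
Qed.

Lemma grad_vertical_continuous X : cyl Om X -> {for X, continuous p}.
Proof.
move=> CX; rewrite (_ : p = fun Y => grad u Y ord0 (rshift n ord0)).
  exact: grad_continuous.
by apply/funext => Y; rewrite /p dotp_vertical.
Qed.

Lemma cutoff_snd_continuous X : {for X, continuous tau}.
Proof.
exact: (continuous_comp_y (has_C1_derivative_continuous (C1_derivative_cutoff r))).
Qed.

Lemma dcutoff_snd_continuous X : {for X, continuous dtau}.
Proof. exact: (continuous_comp_y (C1_derivative_cutoff r).2). Qed.

(** Every term produced by testing is continuous and dominated by these two densities,
    which settles its integrability and its size together. *)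
Lemma dominated_by_energy (W : point -> R) (c1 c2 : R) :
    (forall X, cyl Om X -> {for X, continuous W}) ->
    (forall X, cyl Om X -> `|W X| <= c1 * (w X * g2 X) + c2 * (w X * dtau X ^+ 2)) ->
  mu.-integrable (cyl Om) (fun X => (W X)%:E) /\
  `|\int[mu]_(X in cyl Om) W X| <= c1 * \int[mu]_(X in cyl Om) (w X * g2 X) +
     c2 * \int[mu]_(X in cyl Om) (w X * dtau X ^+ 2).
Proof.
move=> cW WB; have mC := measurable_cyl; have iE := energy_dotp.
have mW : measurable_fun (cyl Om : set mpoint) W.
  by apply: continuous_measurable_xy => //; exact: open_cyl.
have iE1 : mu.-integrable (cyl Om) (EFin \o (fun X => c1 * (w X * g2 X))).
  by apply: eq_integrable (integrableZl mC c1 iE).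
have iE2 : mu.-integrable (cyl Om) (EFin \o (fun X => c2 * (w X * dtau X ^+ 2))).
  by apply: eq_integrable (integrableZl mC c2 cut_int).
have iB : mu.-integrable (cyl Om) (EFin \o (fun X => c1 * (w X * g2 X) + c2 * (w X * dtau X ^+ 2))).
  by apply: eq_integrable (integrableD mC iE1 iE2).
have iW : mu.-integrable (cyl Om) (EFin \o W).
  apply: le_integrable iB => //; first exact/measurable_EFinP.
  move=> X CX; rewrite /= lee_fin; apply: le_trans (ler_norm _); exact: WB.
split => //; apply: (le_trans (le_normr_Rintegral mC iW)).
apply: (@le_trans _ _ (\int[mu]_(X in cyl Om) (c1 * (w X * g2 X) + c2 * (w X * dtau X ^+ 2)))).
  apply: le_Rintegral => //; first exact: integrable_norm.
rewrite RintegralD// RintegralZl// RintegralZl//.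
Qed.

Variable e : R.
Hypothesis e_gt0 : 0 < e.
Hypothesis cut_small :
  (\int[mu]_(X in cyl Om) (w X * dtau X ^+ 2)%:E <= (e ^+ 2)%:E)%E.

Let E := \int[mu]_(X in cyl Om) (w X * g2 X).

Lemma Rintegral_cut_small : \int[mu]_(X in cyl Om) (w X * dtau X ^+ 2) <= e ^+ 2.
Proof.
rewrite -lee_fin /Rintegral fineK//; apply: integrable_fin_num => //.
exact: measurable_cyl.
Qed.

Let tau01 X : 0 <= tau X <= 1.
Proof. by rewrite cutoff_ge0 cutoff_le1. Qed.

Lemma energy_term_integrable (k : R -> R) : continuous k ->
  mu.-integrable (cyl Om) (EFin \o (fun X => w X * (k (u X) * tau X ^+ 2 * g2 X))).
Proof.
move=> ck; have [K hK] := compact_bound (@segment_compact R (- M) M) (fun s _ => ck s).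
have s2C := has_C1_derivative_continuous (C1_derivative_sqr (C1_derivative_cutoff r)).
have [] // := @dominated_by_energy (fun X => w X * (k (u X) * tau X ^+ 2 * g2 X)) K 0.
  move=> X CX; apply: cvgM; first exact: weight_continuous.
  apply: cvgM; last exact: dotp_grad_continuous.
  apply: cvgM; first exact: (continuous_comp_u ck).
  exact: (continuous_comp_y s2C).
move=> X CX; have w0 := weight_gt0 CX.
have kb : `|k (u X)| <= K by apply: hK; rewrite /= in_itv/= -ler_norml; exact: uM.
rewrite mul0r addr0 normrM (gtr0_norm w0) [leRHS]mulrCA; apply: ler_wpM2l.
  exact: ltW.
rewrite normrM (ger0_norm (dotp_ge0 _)) ler_wpM2r ?dotp_ge0//.
move: (tau X) (tau01 X) => t /andP[t0 t1].
rewrite normrM (ger0_norm (sqr_ge0 t)); apply: le_trans kb.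
by rewrite ler_piMr// expr_le1.
Qed.

Section one_profile.
Variables (h dh : R -> R) (H : R).
Hypothesis hC : has_C1_derivative h dh.
Hypothesis H_ge0 : 0 <= H.
Hypothesis hH : forall s, `|s| <= M -> `|h s| <= H /\ `|dh s| <= H.

Let hu_cont X : cyl Om X -> {for X, continuous (h \o u)}.
Proof. exact: (continuous_comp_u (has_C1_derivative_continuous hC)). Qed.

Let dhu_cont X : cyl Om X -> {for X, continuous (dh \o u)}.
Proof. exact: (continuous_comp_u hC.2). Qed.

(** Young's inequality with weight e, using 0 <= tau <= 1 and that p is a component of
    the gradient. Since the integral of w tau'^2 is at most e^2, the integral of w
    times the right-hand side is of order e. *)
Lemma cross_le X : `|2 * tau X * dtau X * p X| <= e * g2 X + e^-1 * dtau X ^+ 2.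
Proof.
have [t0 t1] := andP (tau01 X); have pg : p X ^+ 2 <= g2 X by exact: dotp_vertical_le.
apply: (@le_trans _ _ (2 * (`|dtau X| * `|p X|))).
  have -> : `|2 * tau X * dtau X * p X| = 2 * (tau X * (`|dtau X| * `|p X|)).
    have tE : `|tau X| = tau X by exact: ger0_norm.
    by rewrite 3!normrM tE normr_nat !mulrA.
  by rewrite ler_wpM2l// ler_piMl// mulr_ge0.
move: (dtau X) (p X) (g2 X) pg => d q G qG.
pose b := e^-1 * `|d|; have dE : `|d| = e * b by rewrite /b mulVKf// gt_eqF.
have -> : e^-1 * d ^+ 2 = e * b ^+ 2.
  by rewrite -(real_normK (num_real d)) dE; field; rewrite gt_eqF.
rewrite -(real_normK (num_real q)) in qG.
have bq : 2 * (b * `|q|) <= G + b ^+ 2.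
  have sq0 : 0 <= (`|q| - b) ^+ 2 by exact: sqr_ge0.
  by nra.
rewrite dE (_ : 2 * (e * b * `|q|) = e * (2 * (b * `|q|))); last by ring.
by rewrite -mulrDr ler_pM2l.
Qed.

(** The weak equation for the test function h(u) tau^2. Its gradient has a part in
    h'(u) tau^2 grad u, which is kept, and a part in 2 h(u) tau tau' along the y
    axis, which is estimated by the previous lemma. *)
Lemma weak_estimate :
  `| \int[mux]_(x in Om) (f (u (x, 0)) * h (u (x, 0))) -
     \int[mu]_(X in cyl Om) (w X * (dh (u X) * tau X ^+ 2 * g2 X)) | <=
  H * (E + 1) * e.
Proof.
pose dsigma s := 2 * cutoff r s * dcutoff r s.
have sC : has_C1_derivative (fun s => cutoff r s ^+ 2) dsigma.
  exact: (C1_derivative_sqr (C1_derivative_cutoff r)).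
have mC := measurable_cyl.
have ds_int : mu.-integrable (cyl Om) (fun X => (weight a u X * dsigma X.2 ^+ 2)%:E).
  have [] // := @dominated_by_energy (fun X => w X * dsigma X.2 ^+ 2) 0 4.
    move=> X CX; apply: cvgM; first exact: weight_continuous.
    apply: (@continuous_comp _ _ _ (fun Y : point => dsigma Y.2) (fun s => s ^+ 2)).
      exact: (continuous_comp_y sC.2).
    exact: exprn_continuous.
  move=> X CX; have w0 := weight_gt0 CX.
  rewrite mul0r add0r ger0_norm; last by rewrite mulr_ge0 ?sqr_ge0// ltW.
  rewrite [leRHS]mulrCA; apply: ler_wpM2l; first exact: ltW.
  rewrite /dsigma -/(tau X) -/(dtau X); move: (tau X) (tau01 X) (dtau X) => t /andP[t0 t1] d.
  rewrite (_ : (2 * t * d) ^+ 2 = 4 * (t ^+ 2 * d ^+ 2)); last by ring.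
  by rewrite ler_wpM2l// ler_piMl ?sqr_ge0// expr_le1.
have adm := @test_admissible h dh (fun s => cutoff r s ^+ 2) dsigma hC sC.
have {adm} : admissible Om a u (fun X => h (u X) * cutoff r X.2 ^+ 2)
    (dtest h dh (fun s => cutoff r s ^+ 2) dsigma) (fun x => h (u (x, 0))).
  apply: adm => //.
  - by rewrite cutoff_eq1 ?expr1n// ltW.
  - by move=> y; have := cutoff_ge0 r y; have := cutoff_le1 r y => ? ?; apply/andP; split; nra.
  - by exists (2 * r) => y yr; rewrite cutoff_eq0// expr0n.
move/u_weak.
rewrite [X in (_ + X)%E](_ : _ = 0%E); last first.
  by apply: integral0_eq => X [_ X2]; rewrite g0// mul0r.
rewrite adde0 => weakE.
pose W1 X := w X * (dh (u X) * tau X ^+ 2 * g2 X).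
pose W2 X := w X * (h (u X) * (2 * tau X * dtau X * p X)).
have iW1 : mu.-integrable (cyl Om) (EFin \o W1) by exact: energy_term_integrable hC.2.
have [iW2 W2le] : mu.-integrable (cyl Om) (EFin \o W2) /\ `|\int[mu]_(X in cyl Om) W2 X| <= (H * e) * E + (H * e^-1) * \int[mu]_(X in cyl Om) (w X * dtau X ^+ 2).
  apply: dominated_by_energy => X CX.
    apply: cvgM; first exact: weight_continuous.
    apply: cvgM; first exact: hu_cont.
    apply: cvgM; last exact: grad_vertical_continuous.
    apply: cvgM; last exact: dcutoff_snd_continuous.
    by apply: cvgM; [exact: cvg_cst|exact: cutoff_snd_continuous].
  have w0 := weight_gt0 CX; have [hb _] := hH (uM CX).
  rewrite /W2 normrM (gtr0_norm w0) normrM.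
  rewrite [leRHS](_ : _ = w X * (H * (e * g2 X + e^-1 * dtau X ^+ 2))); last by ring.
  by apply: ler_wpM2l; [exact: ltW|apply: ler_pM => //; exact: cross_le].
have WE : \int[mux]_(x in Om) (f (u (x, 0)) * h (u (x, 0))) =
    \int[mu]_(X in cyl Om) W1 X + \int[mu]_(X in cyl Om) W2 X.
  rewrite -RintegralD// /Rintegral -weakE; congr fine; apply: eq_integral => X _.
  rewrite /dtest dotpDr !dotpZr /W1 /W2 /dsigma -/(tau X) -/(dtau X) -/(g2 X) -/(p X) -/(w X).
  by congr EFin; ring.
rewrite WE addrAC subrr add0r; apply: (le_trans W2le).
have := Rintegral_cut_small; set k := Rintegral _ _ _ => kle.
have -> : H * (E + 1) * e = H * e * E + H * e^-1 * e ^+ 2 by field; rewrite gt_eqF.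
by rewrite lerD2l ler_wpM2l// mulr_ge0// invr_ge0 ltW.
Qed.

(** Stability for the test function h(u) tau, with the matrix replaced by the weight.
    The square of the gradient consists of the term that is kept, of a cross term
    controlled as above, and of w h(u)^2 tau'^2. *)
Lemma stability_estimate :
  \int[mux]_(x in Om) (derive1 (f : R -> R^o) (u (x, 0)) * h (u (x, 0)) ^+ 2) <=
  \int[mu]_(X in cyl Om) (w X * (dh (u X) ^+ 2 * tau X ^+ 2 * g2 X)) +
  H ^+ 2 * (E + 1) * e + H ^+ 2 * e ^+ 2.
Proof.
have sC := C1_derivative_cutoff r.
have mC := measurable_cyl.
have hsqr := has_C1_derivative_continuous (C1_derivative_sqr hC).
have dtau2 X : {for X, continuous (fun Y => dtau Y ^+ 2)}.
  apply: (@continuous_comp _ _ _ dtau (fun s => s ^+ 2)).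
    exact: dcutoff_snd_continuous.
  exact: exprn_continuous.
have : admissible Om a u (fun X => h (u X) * cutoff r X.2)
    (dtest h dh (cutoff r) (dcutoff r)) (fun x => h (u (x, 0))).
  apply: test_admissible => //.
  - by rewrite cutoff_eq1// ltW.
  - by move=> y; rewrite cutoff_ge0 cutoff_le1.
  - by exists (2 * r) => y yr; rewrite cutoff_eq0.
move/u_stable.
rewrite [X in (_ + X - _)%E](_ : _ = 0%E); last first.
  apply: integral0_eq => X [_ X2].
  have -> : (g X.2 : R -> R^o) = cst 0 by apply/funext => s; rewrite g0.
  by rewrite derive1_cst mul0r.
rewrite adde0.
set J := (X in (_ - X)%E).
have iJ : mux.-integrable Om (fun x => (derive1 (f : R -> R^o) (u (x, 0)) * h (u (x, 0)) ^+ 2)%:E).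
  apply: (@integrable_bottom (fun s => derive1 (f : R -> R^o) s * h s ^+ 2)) => s.
  by apply: cvgM; [exact: fC.2|exact: hsqr].
have Jfin : J \is a fin_num by apply: integrable_fin_num => //; exact: measurable_Om.
rewrite sube_ge0 ?Jfin// => JB.
pose G := dtest h dh (cutoff r) (dcutoff r).
have JG : (J <= \int[mu]_(X in cyl Om) (w X * dotp (G X) (G X))%:E)%E.
  apply: (le_trans JB); apply: integral_le_nonmeasurable => X CX.
    by rewrite lee_fin mulr_ge0 ?dotp_ge0// ltW// weight_gt0.
  by rewrite lee_fin; apply: dotp_Bmat_le; case: CX.
pose W1 X := w X * (dh (u X) ^+ 2 * tau X ^+ 2 * g2 X).
pose W2 X := w X * (dh (u X) * h (u X) * (2 * tau X * dtau X * p X)).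
pose W3 X := w X * (h (u X) ^+ 2 * dtau X ^+ 2).
have iW1 : mu.-integrable (cyl Om) (EFin \o W1).
  apply: (@energy_term_integrable (fun s => dh s ^+ 2)) => s.
  by apply: (@continuous_comp _ _ _ dh (fun s => s ^+ 2)); [exact: hC.2|exact: exprn_continuous].
have [iW2 W2le] : mu.-integrable (cyl Om) (EFin \o W2) /\ `|\int[mu]_(X in cyl Om) W2 X| <=
    (H ^+ 2 * e) * E + (H ^+ 2 * e^-1) * \int[mu]_(X in cyl Om) (w X * dtau X ^+ 2).
  apply: dominated_by_energy => X CX.
    apply: cvgM; first exact: weight_continuous.
    apply: cvgM.
      by apply: cvgM; [exact: dhu_cont|exact: hu_cont].
    apply: cvgM; last exact: grad_vertical_continuous.
    apply: cvgM; last exact: dcutoff_snd_continuous.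
    by apply: cvgM; [exact: cvg_cst|exact: cutoff_snd_continuous].
  have w0 := weight_gt0 CX; have [hb dhb] := hH (uM CX).
  rewrite /W2 normrM (gtr0_norm w0) normrM.
  rewrite [leRHS](_ : _ = w X * (H ^+ 2 * (e * g2 X + e^-1 * dtau X ^+ 2))); last by ring.
  apply: ler_wpM2l; first exact: ltW.
  by apply: ler_pM => //; [rewrite normrM expr2 ler_pM|exact: cross_le].
have [iW3 W3le] : mu.-integrable (cyl Om) (EFin \o W3) /\ `|\int[mu]_(X in cyl Om) W3 X| <=
    0 * E + H ^+ 2 * \int[mu]_(X in cyl Om) (w X * dtau X ^+ 2).
  apply: dominated_by_energy => X CX.
    apply: cvgM; first exact: weight_continuous.
    by apply: cvgM; [exact: (continuous_comp_u hsqr)|exact: dtau2].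
  have w0 := weight_gt0 CX; have [hb _] := hH (uM CX).
  rewrite mul0r add0r /W3 normrM (gtr0_norm w0) [leRHS]mulrCA; apply: ler_wpM2l.
    exact: ltW.
  move: (h (u X)) hb (dtau X) => b bH d.
  rewrite ger0_norm; last by apply: mulr_ge0; exact: sqr_ge0.
  apply: ler_wpM2r; first exact: sqr_ge0.
  by rewrite -real_normK ?num_real// ler_sqr ?nnegrE.
have iW12 : mu.-integrable (cyl Om) (EFin \o (fun X => W1 X + W2 X)).
  by apply: eq_integrable (integrableD mC iW1 iW2).
have iW123 : mu.-integrable (cyl Om) (EFin \o (fun X => W1 X + W2 X + W3 X)).
  by apply: eq_integrable (integrableD mC iW12 iW3).
have GW X : w X * dotp (G X) (G X) = W1 X + W2 X + W3 X.
  rewrite /G dotp_dtest /W1 /W2 /W3 -/(tau X) -/(dtau X) -/(g2 X) -/(p X).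
  by ring.
have : fine J <= \int[mu]_(X in cyl Om) (W1 X + W2 X + W3 X).
  rewrite /Rintegral fine_le//; first exact: integrable_fin_num.
  apply: (le_trans JG); rewrite le_eqVlt; apply/orP; left; apply/eqP; apply: eq_integral => X _.
  by congr EFin; exact: GW.
rewrite RintegralD// RintegralD//.
move=> JW; apply: (le_trans JW); rewrite -addrA -addrA lerD2l.
have W2b := le_trans (ler_norm _) W2le; have W3b := le_trans (ler_norm _) W3le.
apply: (le_trans (lerD W2b W3b)).
have := Rintegral_cut_small; set k := Rintegral _ _ _ => kle.
have H20 : 0 <= H ^+ 2 by exact: sqr_ge0.
have -> : H ^+ 2 * (E + 1) * e = H ^+ 2 * e * E + H ^+ 2 * e^-1 * e ^+ 2.
  by field; rewrite gt_eqF.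
rewrite mul0r add0r; apply: lerD; last by rewrite ler_wpM2l.
by rewrite lerD2l ler_wpM2l// mulr_ge0// invr_ge0 ltW.
Qed.

End one_profile.

End one_cutoff.

Let E := \int[mu]_(X in cyl Om) (weight a u X * dotp (grad u X) (grad u X)).

(** The profile h = 1 carries no energy, so the weak estimate leaves only the cross
    term, which tends to zero. *)
Lemma mean_reaction_eq0 : \int[mux]_(x in Om) f (u (x, 0)) = 0.
Proof.
have C1 : has_C1_derivative (cst 1 : R -> R) (cst 0).
  by split; [move=> s; exact: is_derive_cst|exact: cst_continuous].
apply/eqP; rewrite -normr_le0; apply: (@le0_of_small _ _ (1 * (E + 1))) => e /andP[e0 _].
have [r [r0 _ ci cs]] := @growth_cutoff (e ^+ 2) 0 (exprn_gt0 2 e0).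
have := @weak_estimate r r0 ci e e0 cs _ _ 1 C1 ler01.
have b1 (s : R) : `|s| <= M -> `|(cst 1 : R -> R) s| <= 1 /\ `|(cst 0 : R -> R) s| <= 1.
  by rewrite /= normr1 normr0.
move/(_ b1).
rewrite [X in _ - X](_ : _ = 0); last first.
  by rewrite /Rintegral integral0_eq// => X _; rewrite /= !mul0r mulr0.
rewrite subr0 (_ : \int[mux]_(x in Om) (f (u (x, 0)) * cst 1 (u (x, 0))) =
  \int[mux]_(x in Om) f (u (x, 0)))//.
by apply: eq_Rintegral => x _; rewrite mulr1.
Qed.

(** The hypothesis on h gives h'^2 <= h'. Hence the energy term of the stability
    estimate is at most that of the weak estimate, and the two cancel when the
    estimates are subtracted. *)
Lemma stability_profile (h dh : R -> R) : has_C1_derivative h dh ->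
    (forall s, 0 <= dh s <= 1) ->
  0 <= \int[mux]_(x in Om) (h (u (x, 0)) *
    (f (u (x, 0)) - derive1 (f : R -> R^o) (u (x, 0)) * h (u (x, 0)))).
Proof.
move=> hC dh01; have [H H0 hH] := @C1_bounded _ _ hC.
have mC := measurable_cyl; have mO := measurable_Om.
have chh := has_C1_derivative_continuous hC.
have cf := has_C1_derivative_continuous fC.
have i1 : mux.-integrable Om (EFin \o (fun x => f (u (x, 0)) * h (u (x, 0)))).
  apply: (@integrable_bottom (fun s => f s * h s)) => s.
  by apply: cvgM; [exact: cf|exact: chh].
have i2 : mux.-integrable Om (EFin \o (fun x => derive1 (f : R -> R^o) (u (x, 0)) * h (u (x, 0)) ^+ 2)).
  apply: (@integrable_bottom (fun s => derive1 (f : R -> R^o) s * h s ^+ 2)) => s.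
  apply: cvgM; first exact: fC.2.
  exact: (has_C1_derivative_continuous (C1_derivative_sqr hC)).
have -> : \int[mux]_(x in Om) (h (u (x, 0)) *
    (f (u (x, 0)) - derive1 (f : R -> R^o) (u (x, 0)) * h (u (x, 0)))) =
  \int[mux]_(x in Om) (f (u (x, 0)) * h (u (x, 0))) -
  \int[mux]_(x in Om) (derive1 (f : R -> R^o) (u (x, 0)) * h (u (x, 0)) ^+ 2).
  by rewrite -RintegralB//; apply: eq_Rintegral => x _; ring.
rewrite -oppr_le0 opprB.
apply: (@le0_of_small _ _ (H * (E + 1) + H ^+ 2 * (E + 1) + H ^+ 2)) => e /andP[e0 e1].
have [r [r0 _ ci cs]] := @growth_cutoff (e ^+ 2) 0 (exprn_gt0 2 e0).
pose A := \int[mux]_(x in Om) (derive1 (f : R -> R^o) (u (x, 0)) * h (u (x, 0)) ^+ 2).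
pose A1 := \int[mux]_(x in Om) (f (u (x, 0)) * h (u (x, 0))).
pose B := \int[mu]_(X in cyl Om) (weight a u X * (dh (u X) ^+ 2 * cutoff r X.2 ^+ 2 *
    dotp (grad u X) (grad u X))).
pose B1 := \int[mu]_(X in cyl Om) (weight a u X * (dh (u X) * cutoff r X.2 ^+ 2 *
    dotp (grad u X) (grad u X))).
have W : `|A1 - B1| <= H * (E + 1) * e := @weak_estimate r r0 ci e e0 cs _ _ H hC H0 hH.
have S : A <= B + H ^+ 2 * (E + 1) * e + H ^+ 2 * e ^+ 2 :=
  @stability_estimate r r0 ci e e0 cs _ _ H hC H0 hH.
have BB1 : B <= B1.
  apply: le_Rintegral => //.
  - apply: (@energy_term_integrable r ci (fun s => dh s ^+ 2)) => s.
    by apply: (@continuous_comp _ _ _ dh (fun s => s ^+ 2)); [exact: hC.2|exact: exprn_continuous].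
  - exact: (@energy_term_integrable r ci dh hC.2).
  - move=> X CX; apply: ler_wpM2l; first by rewrite ltW// weight_gt0.
    move: (dh (u X)) (dh01 (u X)) (cutoff r X.2) => b /andP[b0 b1] t.
    rewrite ler_wpM2r ?dotp_ge0// ler_wpM2r ?sqr_ge0//.
    by rewrite expr2 ler_piMl.
have e2 : e ^+ 2 <= e by rewrite expr2 ler_piMl// ltW.
have HeHe : H ^+ 2 * e ^+ 2 <= H ^+ 2 * e by rewrite ler_wpM2l// sqr_ge0.
move: W; rewrite ler_norml => /andP[W _].
move: W S BB1 HeHe; rewrite -/A -/A1; clearbody A A1 B B1 => W S BB1 HeHe.
by rewrite !mulrDl; lra.
Qed.

(** For h = id the weak estimate bounds the integral of w tau^2 |grad u|^2 by a multiple
    of e. Near a point where the gradient does not vanish this integral would have a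
    fixed positive lower bound, as soon as tau = 1 there. *)
Lemma grad_eq0 : (forall x, Om x -> f (u (x, 0)) = 0) ->
  forall X, cyl Om X -> grad u X = 0.
Proof.
move=> fu0 X CX.
suff g20 : dotp (grad u X) (grad u X) <= 0.
  apply/rowP => i; rewrite [RHS]mxE; apply/eqP; rewrite -sqrf_eq0 eq_le sqr_ge0 andbT.
  apply: le_trans g20; rewrite /dotp (bigD1 i)//= -expr2 lerDl.
  by apply: sumr_ge0 => j _; rewrite -expr2 sqr_ge0.
rewrite leNgt; apply/negP => g2_gt0.
pose W (Y : point) := weight a u Y * dotp (grad u Y) (grad u Y).
have WX : 0 < W X by rewrite mulr_gt0// weight_gt0.
have cW : {for X, continuous W}.
  by apply: cvgM; [exact: weight_continuous|exact: dotp_grad_continuous].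
have : \forall Y \near X, cyl Om Y /\ W X / 2 <= W Y.
  have near1 : \near X, cyl Om X by apply: open_nbhs_nbhs; split => //; exact: open_cyl.
  have near2 : \forall Y \near X, W X / 2 <= W Y.
    by apply: (cvgr_ge (W X) cW); rewrite ltr_pdivrMr// mulr_natr mulr2n ltrDl.
  exact: filterI near1 near2.
move=> /nbhs_ballP[d /= d0 dB].
have WE Y : W Y = weight a u Y * dotp (grad u Y) (grad u Y) by [].
pose m := (d *+ 2) ^+ n.+1.
have m0 : 0 < m by rewrite exprn_gt0// mulrn_wgt0.
have muB : (m%:E <= mu (ball X d))%E by rewrite lebesgue_xy_ball.
have C1 : has_C1_derivative (id : R -> R) (cst 1).
  by split; [move=> s; exact: is_derive_id|exact: cst_continuous].
have [H H0 hH] := C1_bounded C1.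
have WXm : W X / 2 * m <= 0; last first.
  by move: WXm; rewrite leNgt mulr_gt0// divr_gt0.
apply: (@le0_of_small _ _ (H * (E + 1))) => e /andP[e0 _].
(* r >= X.2 + d ensures that the cutoff is 1 on the ball. *)
have [r [r0 Xr ci cs]] := @growth_cutoff (e ^+ 2) (X.2 + d) (exprn_gt0 2 e0).
have := @weak_estimate r r0 ci e e0 cs _ _ H C1 H0 hH.
rewrite [X in `|X - _|](_ : _ = 0); last first.
  by rewrite /Rintegral integral0_eq// => x Ox; rewrite fu0// mul0r.
rewrite sub0r normrN => West; apply: le_trans (le_trans (ler_norm _) West).
apply: (@Rintegral_lower_bound _ mpoint _ mu (cyl Om) (ball X d)) => //.
- exact: measurable_cyl.
- by apply: open_measurable_xy; exact: ball_open.
- by move=> Y /dB[].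
- by rewrite divr_ge0// ltW.
- exact: (@energy_term_integrable r ci (cst 1) C1.2).
- move=> Y CY; rewrite mulr_ge0//; first by rewrite ltW// weight_gt0.
  by rewrite /= mul1r mulr_ge0 ?dotp_ge0 ?sqr_ge0.
- move=> Y /[dup] XY /dB[CY WY]; rewrite /= cutoff_eq1//.
    by rewrite expr1n mul1r mul1r.
  apply: le_trans Xr; case: XY => _; rewrite -ball_normE /ball_/= => XY.
  by move: XY; rewrite ltr_norml => /andP[? ?]; lra.
Qed.

End test_functions.

(** * Strictly convex reactions *)

Section convex_reaction.
Context {R : realType} {n : nat}.
Local Notation mux := (lebesgue_rV R n).
Variables (Om : set 'rV[R]_n) (M : R) (F dF : R -> R) (V : 'rV[R]_n -> R).
Hypotheses (oOm : open Om) (bOm : bounded_set Om).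
Hypothesis V_cont : forall x, Om x -> {for x, continuous V}.
Hypothesis V_bound : forall x, Om x -> `|V x| <= M.
Hypothesis FC : has_C1_derivative F dF.

Lemma Rintegral_le0_eq0 (k : R -> R) : continuous k ->
    (forall x, Om x -> 0 <= k (V x)) -> \int[mux]_(x in Om) k (V x) <= 0 ->
  forall x, Om x -> k (V x) = 0.
Proof.
move=> ck k0 Ik x Ox; apply/eqP; rewrite eq_le k0// andbT leNgt; apply/negP => kx.
have ckV : {for x, continuous (k \o V)}.
  by apply: continuous_comp; [exact: V_cont|exact: ck].
have : \forall z \near x, Om z /\ k (V x) / 2 <= k (V z).
  have near1 : \near x, Om x by exact: open_nbhs_nbhs.
  have near2 : \forall z \near x, k (V x) / 2 <= (k \o V) z.
    by apply: (cvgr_ge (k (V x)) ckV); rewrite ltr_pdivrMr// mulr_natr mulr2n ltrDl.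
  exact: filterI near1 near2.
move=> /nbhs_ballP[d /= d0 dB].
have muB : (((d *+ 2) ^+ n)%:E <= mux (ball x d))%E by rewrite lebesgue_rV_ball.
have := @Rintegral_lower_bound _ _ _ mux Om (ball x d) (k (V x) / 2)
  ((d *+ 2) ^+ n) (k \o V) (open_measurable_rV oOm) (measurable_rV_ball _ _).
have BO : ball x d `<=` Om by move=> z /dB[].
have k20 : 0 < k (V x) / 2 by rewrite divr_gt0.
move=> /(_ BO muB (ltW k20) (integrable_comp_bounded oOm bOm V_cont V_bound ck) k0).
have cB z : ball x d z -> k (V x) / 2 <= (k \o V) z by move=> /dB[].
move=> /(_ cB) h; have := le_trans h Ik.
by rewrite leNgt mulr_gt0// exprn_gt0// mulrn_wgt0.
Qed.

(** If F(V(x)) < 0, take for k a ramp such that s - k(s) stays in a small interval below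
    V(x) on which F < 0. By the tangent inequality F(s) - F'(s) k(s) < F(s - k(s)) < 0
    wherever k(s) > 0, so the integral in the last hypothesis is negative: a
    contradiction. Thus F(V) >= 0, and a nonnegative continuous function with zero
    mean vanishes. *)
Lemma convex_reaction_eq0 : strictly_convex F ->
    \int[mux]_(x in Om) F (V x) = 0 ->
    (forall k dk, has_C1_derivative k dk -> (forall s, 0 <= dk s <= 1) ->
      0 <= \int[mux]_(x in Om) (k (V x) * (F (V x) - dF (V x) * k (V x)))) ->
  forall x, Om x -> F (V x) = 0.
Proof.
move=> cvF mean0 stab; have cF := has_C1_derivative_continuous FC.
suff F0 x : Om x -> 0 <= F (V x) by apply: Rintegral_le0_eq0; rewrite ?mean0.
move=> Ox; rewrite leNgt; apply/negP => FV0.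
have : \forall s \near V x, F s < 0 by apply: (@cvgr_lt R R (nbhs (V x)) _ F (F (V x)) _ 0 FV0); exact: cF.
move=> /nbhs_ballP[d /= d0 dB].
have d40 : 0 < d / 4 by rewrite divr_gt0.
(* [c, c + d / 4] lies in the ball of radius d about V x and to the left of V x. *)
pose c := V x - d / 2; pose k := ramp c (d / 4).
have kC := C1_derivative_ramp c d40; rewrite -/k in kC.
have ck := has_C1_derivative_continuous kC.
pose Phi s := - (k s * (F s - dF s * k s)).
have cPhi : continuous Phi.
  move=> s; apply: cvgN; apply: cvgM; first exact: ck.
  by apply: cvgB; [exact: cF|apply: cvgM; [exact: FC.2|exact: ck]].
have Phi_gt s : c < s -> 0 < Phi s.
  move=> cs; have [k0 /andP[k1 k2]] := ramp_gt cs d40; rewrite -/k in k0 k1 k2.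
  rewrite /Phi -mulrN mulr_gt0// oppr_gt0.
  have sk : s != s - k s by apply/eqP => sE; lra.
  have := strictly_convex_tangent cvF (FC.1 s) sk.
  have : F (s - k s) < 0.
    apply: dB; rewrite -ball_normE /ball_/= ltr_norml; rewrite /c in k1 k2.
    by apply/andP; split; lra.
  by rewrite [s - k s - s]addrC addKr mulrN => ? ?; lra.
have Phi_ge s : 0 <= Phi s.
  have [sc|/Phi_gt/ltW//] := leP s c.
  by rewrite /Phi /k ramp_le// mul0r oppr0.
have := @Rintegral_le0_eq0 Phi cPhi (fun x _ => Phi_ge (V x)).
have -> : \int[mux]_(x in Om) Phi (V x) = - \int[mux]_(x in Om) (k (V x) * (F (V x) - dF (V x) * k (V x))).
  rewrite -mulN1r -RintegralZl//.
  - by apply: eq_Rintegral => z _; rewrite mulN1r.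
  - exact: open_measurable_rV.
  - apply: (@integrable_comp_bounded _ _ Om M V (fun s => k s * (F s - dF s * k s))) => // s.
    apply: cvgM; first exact: ck.
    by apply: cvgB; [exact: cF|apply: cvgM; [exact: FC.2|exact: ck]].
rewrite oppr_le0 => /(_ (stab _ _ kC (fun s => dramp_itv c s d40)) x Ox).
apply/eqP; rewrite gt_eqF// Phi_gt// /c gtrBl divr_gt0//.
Qed.

End convex_reaction.

(** * Functions with vanishing gradient on a cylinder *)

Section constancy.
Context {R : realType} {n : nat}.
Local Notation point := ('rV[R]_n * R)%type.
Variables (Om : set 'rV[R]_n) (u : point -> R).
Hypothesis oOm : open Om.
Hypothesis u_derive : forall X k, cyl Om X -> is_derive X (axis k) u 0.

Lemma constant_on_segment (X : point) k (s t : R) :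
    (forall c, s <= c <= t -> cyl Om (c *: axis k + X)) -> s <= t ->
  u (s *: axis k + X) = u (t *: axis k + X).
Proof.
move=> CX st; pose G := fun c : R => u (c *: axis k + X) : R^o.
have dG c : s <= c <= t -> is_derive c (1 : R) G 0.
  move=> /CX Cc; have dc := u_derive k Cc.
  have := @is_derive_line _ _ (u : point -> R^o) X (axis k) c (@ex_derive _ _ _ _ _ _ _ dc).
  by rewrite (@derive_val _ _ _ _ _ _ _ dc).
have [||c _] := @MVT_segment R G (cst 0) s t st.
- move=> c; rewrite in_itv/= => /andP[sc ct]; by apply: dG; rewrite !ltW.
- apply: derivable_within_continuous => c; rewrite in_itv/= => sct.
  exact: (@ex_derive _ _ _ _ _ _ _ (dG c sct)).
by rewrite /= mul0r => /eqP; rewrite subr_eq0 => /eqP/esym.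
Qed.

Lemma constant_vertical x y : Om x -> 0 < y -> u (x, y) = u (x, 1).
Proof.
move=> Ox y0.
have E (z : R) : (x, z) = z *: axis (rshift n ord0) + (x, 0) :> point.
  rewrite /axis (unsplitK (inr ord0)) /axis_y; congr pair => /=.
    by rewrite scaler0 add0r.
  by rewrite [z *: _]mulr1 addr0.
have C c : 0 < c -> cyl Om (c *: axis (rshift n ord0) + (x, 0)) by rewrite -E.
rewrite (E y) (E 1); case: (leP y 1) => y1.
  apply: constant_on_segment => // c /andP[yc _]; apply: C; exact: lt_le_trans yc.
apply/esym/constant_on_segment; last exact: ltW.
by move=> c /andP[yc _]; apply: C; exact: lt_le_trans yc.
Qed.

(** From x to z one moves inside the box along one coordinate axis after the other; the
    intermediate points mix coordinates of z and x. *)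
Lemma constant_ball x d z : 0 < d -> ball x d `<=` Om -> ball x d z ->
  u (z, 1) = u (x, 1).
Proof.
move=> d0 BO Bz.
pose mix (s : seq 'I_n) : 'rV[R]_n :=
  \row_i (if i \in s then z ord0 i else x ord0 i).
suff mixE s : u (mix s, 1) = u (x, 1).
  rewrite -(mixE (enum 'I_n)); congr (u (_, _)).
  by apply/rowP => i; rewrite mxE mem_enum.
elim: s => [|i s <-].
  by congr (u (_, _)); apply/rowP => i; rewrite mxE.
have [si|si] := boolP (i \in s).
  congr (u (_, _)); apply/rowP => j; rewrite !mxE in_cons.
  by case: eqP => // ->; rewrite si.
pose X : point := (mix s, 1); pose t := z ord0 i - x ord0 i.
have XE : X = 0 *: axis (lshift 1 i) + X by rewrite scale0r add0r.
have axE (c : R) : c *: axis (lshift 1 i) + X = (c *: delta_mx ord0 i + mix s, 1) :> point.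
  rewrite /axis (unsplitK (inl i)) /axis_x /X; congr pair => /=.
  by rewrite scaler0 add0r.
have XtE : (mix (i :: s), 1) = t *: axis (lshift 1 i) + X.
  rewrite axE; congr pair; apply/rowP => j; rewrite !mxE in_cons eqxx/=.
  case: eqP => [->|_] /=; last by rewrite mulr0 add0r.
  by rewrite (negbTE si) mulr1 /t subrK.
have C c : Num.min 0 t <= c <= Num.max 0 t -> cyl Om (c *: axis (lshift 1 i) + X).
  move=> /andP[c1 c2]; rewrite axE; split => //=; apply: BO; split => // a j.
  rewrite [a]ord1 !mxE eqxx/=; case: Bz => _ /(_ ord0 j).
  rewrite -!ball_normE /ball_/=.
  case: eqP => [->|_] /=; last first.
    by rewrite mulr0 add0r; case: ifP => // _ _; rewrite subrr normr0.
  rewrite (negbTE si) mulr1 => xz; apply: le_lt_trans xz.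
  rewrite opprD addrCA subrr addr0 normrN -[leRHS]normrN opprB -/t.
  case: (leP 0 t) c1 c2 => [t0 c1 c2|t0 c1 c2].
    by rewrite !ger0_norm.
  by rewrite !ler0_norm ?lerN2// ltW.
change (u (mix (i :: s), 1) = u X); rewrite XtE {2}XE.
case: (leP 0 t) C => [t0 C|t0 C].
  by apply/esym/constant_on_segment.
by apply: constant_on_segment; rewrite ?ltW.
Qed.

Lemma constant_of_grad_eq0 : connected Om -> Om !=set0 ->
  exists c : R, forall X, cyl Om X -> u X = c.
Proof.
move=> cOm [x0 Ox0]; exists (u (x0, 1)) => -[x y] [/= Ox y0].
rewrite constant_vertical//.
have locc z : Om z -> exists2 d : R, 0 < d & ball z d `<=` Om /\ forall z', ball z d z' -> u (z', 1) = u (z, 1).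
  move=> Oz; have /nbhs_ballP[d /= d0 dB] : \near z, Om z by exact: open_nbhs_nbhs.
  by exists d => //; split => // z' Bz'; exact: constant_ball Bz'.
pose B := [set z | Om z /\ u (z, 1) = u (x0, 1)].
pose C := [set z | Om z /\ u (z, 1) != u (x0, 1)].
suff BE : B = Om by have [] : B x by rewrite BE.
have oB : open B.
  rewrite openE => z [Oz uz]; have [d d0 [dO dc]] := locc z Oz.
  apply/nbhs_ballP; exists d => //= z' Bz'; split; first exact: dO.
  by rewrite dc.
have oC : open C.
  rewrite openE => z [Oz uz]; have [d d0 [dO dc]] := locc z Oz.
  apply/nbhs_ballP; exists d => //= z' Bz'; split; first exact: dO.
  by rewrite dc.
apply: cOm; first by exists x0.
  exists B => //; apply/seteqP; split => [z Bz|z []//].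
  by split => //; case: Bz.
exists (~` C); first exact: open_closedC.
apply/seteqP; split => [z [Oz uz]|z [Oz nCz]].
  by split => // -[_]; rewrite uz eqxx.
split => //; apply/eqP/negPn/negP => uz; exact: nCz.
Qed.

End constancy.

(** * Reduction of the concave case, and the theorem *)

Section reflection.
Context {R : realType}.

(** The change of unknown u into -u turns the reaction f into s |-> - f(-s), which is
    strictly convex when f is strictly concave, and turns profiles into profiles. *)
Lemma C1_derivative_reflect (h dh : R -> R) : has_C1_derivative h dh ->
  has_C1_derivative (fun s => - h (- s)) (fun s => dh (- s)).
Proof.
move=> [hD hC]; split => [s|s].
  have d1 : is_derive s (1 : R) (h \o -%R) (dh (- s) * - 1).
    exact: is_derive1_comp.
  by apply: (is_derive_eq (is_deriveN d1)); rewrite mulrN1 opprK.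
by apply: continuous_comp; [exact: opp_continuous|exact: hC].
Qed.

Lemma strictly_concave_reflect (f : R -> R) :
  strictly_concave f -> strictly_convex (fun s => - f (- s)).
Proof.
move=> cf s t l st l01; have := @cf (- s) (- t) l _ l01.
by rewrite eqr_opp st => /(_ isT); rewrite !mulrN -opprD.
Qed.

End reflection.

Theorem theorem1p4 (R : realType) (n : nat) (hn : (0 < n)%N)
  (alpha : R) (halpha : 0 < alpha < 1)
  (Om : set 'rV[R]_n) (hOm : bounded_domain Om) (hOmC : of_class Om 4 alpha)
  (f : R -> R) (hf : Cka [set: R^o] 2 alpha (f : R^o -> R^o))
  (g : R -> R -> R) (hg : reaction g)
  (a : R -> R -> R) (ha : diffusion_coefficient a)
  (ha_t : forall y t : R, 0 < y -> 0 < t -> derive1 (a y : R -> R^o) t <= 0)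
  (hg0 : forall y s : R, 0 < y -> g y s = 0)
  (u : 'rV[R]_n * R -> R)
  (hu : solution Om a g f u)
  (hu_bounded : exists M : R, forall X, cyl Om X -> `|u X| <= M)
  (hu_stable : stable Om a g f u)
  (hu_energy : (lebesgue_xy R n).-integrable (cyl Om)
     (fun X => (weight a u X * enorm (grad u X) ^+ 2)%:E))
  (hu_growth :
     (((r ^+ 2)^-1)%:E *
        \int[lebesgue_xy R n]_(X in slab Om r (2 * r)) (weight a u X)%:E)%E
       @[r --> +oo] --> 0%E)
  (hu_flux : extends_continuously (cyl Om) (cyl_closed Om)
     (fun X => weight a u X * 'D_axis_y u X : R^o))
  (hf_conv : strictly_convex f \/ strictly_concave f) :
  exists c : R, forall X, cyl Om X -> u X = c.
Proof.
have [oOm cOm Om0 bOm] := hOm.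
have [a_cont _ a_pos _ _] := ha.
have a_gt0 y t : 0 < y -> 0 <= t -> 0 < a y t by move=> y0 /(a_pos y t y0)[].
have [u_cont u_C2 _ _ _ _ _ u_weak] := hu.
have [M uM] := hu_bounded.
have fC : has_C1_derivative f (derive1 (f : R -> R^o)).
  split=> [s|s].
    by rewrite derive1E; apply: derivableP; apply: (hf.1 [::] isT).2.
  rewrite (_ : derive1 _ = 'D_1 (f : R^o -> R^o)).
    exact: (hf.1 [:: 1] isT).1.
  by apply/funext => t; rewrite derive1E.
have mean0 := mean_reaction_eq0 oOm bOm a_cont a_gt0 u_cont u_C2 uM hu_energy
  hu_growth hg0 u_weak.
have stab := stability_profile oOm bOm a_cont a_gt0 u_cont u_C2 uM hu_energy
  hu_growth hg0 ha_t u_weak hu_stable fC.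
pose U x := u (x, 0).
have U_cont x : Om x -> {for x, continuous U} by exact: u_bottom_continuous.
have U_bound x : Om x -> `|U x| <= M by exact: u_bottom_bounded.
have fU0 x : Om x -> f (U x) = 0.
  case: hf_conv => [cvx|ccv] Ox.
    exact: (convex_reaction_eq0 oOm bOm U_cont U_bound fC cvx mean0 stab).
  have fC' := C1_derivative_reflect fC.
  have V_cont z : Om z -> {for z, continuous (fun x => - U x)}.
    move=> Oz; apply: (@continuous_comp _ _ _ U -%R); last exact: opp_continuous.
    exact: U_cont.
  have V_bound z : Om z -> `|- U z| <= M by rewrite normrN; exact: U_bound.
  have := convex_reaction_eq0 oOm bOm V_cont V_bound fC' (strictly_concave_reflect ccv).
  move=> /(_ _ _ x Ox) F0; apply/eqP; rewrite -oppr_eq0; apply/eqP.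
  rewrite -{1}[U x]opprK; apply: F0.
    transitivity (\int[lebesgue_rV R n]_(x in Om) (- 1 * f (u (x, 0)))).
      by apply: eq_Rintegral => z _; rewrite /= opprK mulN1r.
    rewrite RintegralZl ?mean0 ?mulr0//; first exact: open_measurable_rV.
    exact: (integrable_comp_bounded oOm bOm U_cont U_bound (has_C1_derivative_continuous fC)).
  move=> k dk kC dk01.
  have := stab _ _ (C1_derivative_reflect kC) (fun s => dk01 (- s)).
  congr (0 <= _); apply: eq_Rintegral => z _.
  by rewrite /= opprK /U; ring.
have grad0 := grad_eq0 oOm bOm a_cont a_gt0 u_cont u_C2 uM hu_energy hu_growth
  hg0 u_weak fU0.
apply: constant_of_grad_eq0 => // X k CX.
have -> : 0 = 'D_(axis k) u X.
  by have /rowP/(_ k) := grad0 X CX; rewrite !mxE => ->.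
exact: (u_is_derive u_C2).
Qed.
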